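(* Let $n\ge 2$ be an integer and let $A=(a_{j,r})\in\mathbb{R}^{n\times n}$ be a real matrix. Let $\pi$ be a uniformly distributed random permutation of $\{1,\dots,n\}$, let $S_n=\sum_{j=1}^n a_{j,\pi(j)}$, $\mu=\mathrm{E}S_n$, $\sigma=(\mathrm{Var}\,S_n)^{1/2}$, and assume $\sigma^2>0$. Put $S_n^*=(S_n-\mu)/\sigma$ and $$\Delta=\sup_{x\in\mathbb{R}}|P(S_n^*\le x)-\Phi(x)|,$$ where $\Phi$ is the distribution function of the standard normal distribution. Let $C_1=15.84$ and $C_2=0.65$ (so that $C_1C_2\le 10.3$). Then $$\Delta\le\frac{C_1}{\sigma^2}\,\gamma\Bigl(\frac{C_2}{\sigma}\Bigr),$$ where $\gamma$ is the function defined in the context.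
   Context: For a matrix $A=(a_{j,r})\in\mathbb{R}^{n\times n}$ with $n\ge2$ and $j,k,r,s\in\{1,\dots,n\}$, let $b_{j,k,r,s}=a_{j,r}-a_{k,r}-a_{j,s}+a_{k,s}$. For $x\in\mathbb{R}$ define $$\gamma(x)=\frac{1}{n^2(n-1)}\sum_{j\ne k}\ \sum_{r\ne s}b_{j,k,r,s}^2\min\{1,|x\,b_{j,k,r,s}|\},$$ where the sums run over all ordered pairs $(j,k)$ and $(r,s)$ of distinct elements of $\{1,\dots,n\}$. *)

(* Defs.v *)
From HB Require Import structures.
From mathcomp Require Import all_boot all_order all_algebra all_fingroup.
From mathcomp Require Import all_classical all_reals all_analysis.

Set Implicit Arguments.
Unset Strict Implicit.
Unset Printing Implicit Defensive.

Import Order.TTheory GRing.Theory Num.Theory.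

Local Open Scope classical_set_scope.
Local Open Scope ring_scope.

Section second_differences.
Context {R : realType} {n : nat}.
Variable A : 'M[R]_n.

Definition bdiff (j k r s : 'I_n) : R := A j r - A k r - A j s + A k s.

Definition gamma (x : R) : R :=
  (n%:R ^+ 2 * (n%:R - 1))^-1 *
  \sum_(j < n) \sum_(k < n | j != k) \sum_(r < n) \sum_(s < n | r != s)
    (bdiff j k r s ^+ 2 * Num.min 1 `|x * bdiff j k r s|).

End second_differences.

(* [{perm 'I_n}] carries no canonical sigma-algebra, so measurability of the
   random permutation is required fibrewise. *)
Definition uniform_random_perm d (T : measurableType d) (R : realType)
    (P : probability T R) (n : nat) (p : T -> 'S_n) : Prop :=
  forall s : 'S_n,
    measurable (p @^-1` [set s]) /\ P (p @^-1` [set s]) = (n`!%:R^-1)%:E.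

Section permutation_statistic.
Context d (T : measurableType d) (R : realType) (P : probability T R) (n : nat).
Variables (A : 'M[R]_n) (p : T -> 'S_n).

Definition perm_sum (w : T) : R := \sum_(j < n) A j (p w j).

Definition perm_sum_mean : R := fine 'E_P[perm_sum].

Definition perm_sum_sd : R := Num.sqrt (fine 'V_P[perm_sum]).

Definition perm_sum_std (w : T) : R :=
  (perm_sum w - perm_sum_mean) / perm_sum_sd.

End permutation_statistic.

Definition Phi {R : realType} (x : R) : R :=
  fine (normal_prob (0 : R) 1 `]-oo, x]).

(* The set is nonempty and, for measurable [X], bounded by 1, so the real-valued
   [sup] is the genuine supremum. *)
Definition dist_to_normal d (T : measurableType d) (R : realType)
    (P : probability T R) (X : T -> R) : R :=
  sup [set `|fine (P [set w | X w <= x]) - Phi x| | x in [set: R]].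

Definition C1 {R : realType} : R := 1584 / 100.
Definition C2 {R : realType} : R := 65 / 100.

(* Main.v *)
(* Stein's method for exchangeable pairs. After normalization, let W be the
   statistic and let f be the Stein solution for the indicator of ]-oo, z].
   Composing the permutation with a random transposition (i j) yields
   E [W f(W)] = c * sum_(i, j) E [D (f(W2) - f(W2 - D))], where W2 is obtained from W
   by two further transpositions (i k), (j l) with random k, l. Since the images of
   i and j after these transpositions form a uniform pair of distinct points
   independent of W, one has c * sum D^2 = 1 identically, so P(W <= z) - Phi(z) is
   an average of D^2 f'(W) - D (f(W2) - f(W2 - D)). This is at most D^2 times the
   oscillation of f' around W on a scale eta comparable to the increments.
   Now f' is a monotone function of range at most 1 plus an indicator, so, given the
   images of i, j, k, l, its expected oscillation is at most twice the largest
   conditional probability that W lies in an interval of length 2 eta. That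
   probability is O(eta + beta), with beta a quarter of the normalized gamma, by a
   second application of Stein's identity, to a clamped identity function; the
   fluctuations of the quadratic statistic occurring there are controlled by an Efron-Stein inequality on the symmetric group. The
   constants leave enough room to assume that beta is small, whence n >= 100. *)
Require Import Defs.
From HB Require Import structures.
From mathcomp Require Import all_boot all_order all_algebra all_fingroup.
From mathcomp Require Import all_classical all_reals all_analysis.
From mathcomp Require Import fintype finset ring lra zify.
Import Order.TTheory GRing.Theory Num.Theory.
Import numFieldNormedType.Exports.
Local Open Scope ring_scope.

(** * Mills ratios and the normal Stein equation *)

Section mills_ratio.
Context {R : realType}.

Lemma derive_ge0_homo (f df : R -> R) :
  (forall x : R, is_derive x 1 f (df x)) -> (forall x, 0 <= df x) ->
  {homo f : x y / x <= y}.
Proof.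
move=> fdf df0 x y xy.
have [c _ fc] : exists2 c, c \in `[x, y]%R & f y - f x = df c * (y - x).
  apply: MVT_segment => //.
  apply: continuous_subspaceT => t.
  exact/differentiable_continuous/derivable1_diffP/(@ex_derive _ _ _ _ _ _ _ (fdf t)).
by rewrite -subr_ge0 fc mulr_ge0// subr_ge0.
Qed.

(** Since [expR t] is at least [t ^ 2 / 4], the product [t * expR (- t)] is at most [4 / t]: this is
    the limit 0 of [y * expR y] at minus infinity, with a witness left of [w]. *)
Lemma mul_expR_ge_near_Ny (e w : R) : 0 < e ->
  exists y, [/\ y <= w, y < 0 & - e <= y * expR y].
Proof.
move=> e0; pose t := `|w| + 4 / e + 1.
have e4 : 0 < 4 / e by rewrite divr_gt0.
have w0 : 0 <= `|w| by [].
have t0 : 0 < t by rewrite /t; lra.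
exists (- t); split; [|lra|].
  have := ler_norm (- w); rewrite normrN /t; lra.
have h : t / 2 <= expR (t / 2) by have := expR_ge1Dx (t / 2); lra.
have h2 : t ^+ 2 / 4 <= expR t.
  have -> : expR t = expR (t / 2) ^+ 2.
    by rewrite expr2 -expRD; congr expR; field.
  have -> : t ^+ 2 / 4 = (t / 2) ^+ 2 by field.
  by apply: lerXn2r; rewrite ?nnegrE ?expR_ge0 ?divr_ge0 // ltW.
rewrite mulNr lerN2 expRN ler_pdivrMr ?expR_gt0//.
apply: le_trans (ler_wpM2l (ltW e0) h2).
have te : 4 <= t * e.
  rewrite -ler_pdivrMr//; rewrite /t; lra.
have -> : e * (t ^+ 2 / 4) = t * (t * e / 4) by field.
by apply: ler_peMr; [exact: ltW | lra].
Qed.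

(** [F] is an abstract primitive of a Gaussian density that vanishes at minus infinity, so that the
    same results serve [Phi] and its reflection. *)
Variables (c : R) (F : R -> R).
Hypothesis c_gt0 : 0 < c.
Let phi (x : R) := c * expR (- (x ^+ 2) / 2).
Hypothesis dF : forall x : R, is_derive x 1 F (phi x).
Hypothesis F_ge0 : forall x, 0 <= F x.
Hypothesis F_Ny : forall e w : R, 0 < e -> exists2 y, y <= w & F y < e.

Let phi_gt0 x : 0 < phi x.
Proof. by rewrite mulr_gt0 ?expR_gt0. Qed.

Let dphi (x : R) : is_derive x 1 phi (- (x * phi x)).
Proof.
rewrite /phi; apply: is_derive_eq.
rewrite /GRing.scale /=; by field. Qed.

Let C := c * expR (2^-1).
Let C_gt0 : 0 < C. Proof. by rewrite mulr_gt0 ?expR_gt0. Qed.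

Let phi_le (x : R) : phi x <= C * expR x.
Proof.
rewrite /phi /C -mulrA ler_pM2l// -expRD ler_expR.
by have := sqr_ge0 (x + 1); rewrite sqrrD; lra.
Qed.

(** By [phi_le], [C * expR x - F x] is nondecreasing, and far to the left it exceeds any negative
    number. *)
Let F_le (x : R) : F x <= C * expR x.
Proof.
apply/ler_addgt0Pr => e e0.
have [y yx Fy] := F_Ny e x e0.
have := @derive_ge0_homo (fun x => C * expR x - F x)
  (fun x => C * expR x - phi x) _ _ y x yx.
have H1 (t : R) : is_derive t (1:R) (fun x => C * expR x - F x)
    (C * expR t - phi t).
  by apply: is_derive_eq; rewrite /GRing.scale /=; by ring.
have H2 (t : R) : 0 <= C * expR t - phi t by rewrite subr_ge0.
move=> /(_ H1 H2).
have : 0 < C * expR y by rewrite mulr_gt0 ?expR_gt0.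
lra.
Qed.

(** A nondecreasing function stays above its limit at minus infinity, and the minorant
    [a * (x * expR x)] tends to 0 there. *)
Let homo_ge0 (f df : R -> R) (a : R) : 0 < a ->
  (forall x : R, is_derive x 1 f (df x)) -> (forall x, 0 <= df x) ->
  (forall x, x < 0 -> a * (x * expR x) <= f x) -> forall x, 0 <= f x.
Proof.
move=> a0 fdf df0 fa x; apply/ler_addgt0Pr => e e0.
have [y [yx y0 ye]] := mul_expR_ge_near_Ny (e / a) x (divr_gt0 e0 a0).
have := derive_ge0_homo _ _ fdf df0 _ _ yx.
have := fa _ y0.
have : a * (- (e / a)) <= a * (y * expR y) by rewrite ler_pM2l.
have -> : a * (- (e / a)) = - e by field; rewrite gt_eqF.
lra.
Qed.

(** The derivative of this expression is [F]. Divided by [phi], it becomes [dmills]. *)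
Let L_ge0 (x : R) : 0 <= x * F x + phi x.
Proof.
apply: (homo_ge0 (fun x => x * F x + phi x) F C) => // {}x.
  apply: is_derive_eq; rewrite /GRing.scale /= /phi; by field.
move=> x0; have := phi_gt0 x.
have : x * (C * expR x) <= x * F x by rewrite ler_nM2l.
have -> : x * (C * expR x) = C * (x * expR x) by ring.
lra.
Qed.

(** The derivative is twice the expression of [L_ge0]. Divided by [phi], this is the derivative of
    [dmills], so the Mills ratio is convex. *)
Let K_ge0 (x : R) : 0 <= (1 + x ^+ 2) * F x + x * phi x.
Proof.
apply: (homo_ge0 (fun x => (1 + x ^+ 2) * F x + x * phi x)
  (fun x => 2 * (x * F x + phi x)) C) => // {}x.
- apply: is_derive_eq; rewrite /GRing.scale /= /phi; by field.
- by rewrite mulr_ge0.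
move=> x0; have : 0 <= (1 + x ^+ 2) * F x.
  by rewrite mulr_ge0// addr_ge0// sqr_ge0.
have : x * (C * expR x) <= x * phi x by rewrite ler_nM2l.
have -> : x * (C * expR x) = C * (x * expR x) by ring.
lra.
Qed.

(** The quotient [F / phi]; it solves [m' = 1 + x * m], which gives [dmills]. *)
Definition mills (x : R) := F x * (c^-1 * expR (x ^+ 2 / 2)).

Lemma mills_phi (x : R) : mills x * phi x = F x.
Proof.
have E : expR (x ^+ 2 / 2) * expR (- x ^+ 2 / 2) = 1.
  by rewrite -expRD mulNr subrr expR0.
rewrite /mills /phi.
transitivity (F x * (c^-1 * c) * (expR (x ^+ 2 / 2) * expR (- x ^+ 2 / 2))).
  by ring.
by rewrite E mulVf ?gt_eqF// !mulr1.
Qed.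

Definition dmills (x : R) := 1 + x * mills x.

Let is_derive_mills (x : R) : is_derive x 1 mills (dmills x).
Proof.
rewrite /mills; apply: is_derive_eq; rewrite /GRing.scale /=.
rewrite /dmills /mills /phi.
have E : expR (- x ^+ 2 / 2) = (expR (x ^+ 2 / 2))^-1.
  by rewrite -expRN mulNr.
rewrite E; field.
by rewrite !gt_eqF// expR_gt0.
Qed.

Lemma dmills_ge0 (x : R) : 0 <= dmills x.
Proof.
rewrite -(pmulr_lge0 _ (phi_gt0 x)) /dmills mulrDl -mulrA mills_phi mul1r.
by rewrite addrC.
Qed.

Lemma dmills_homo : {homo dmills : x y / x <= y}.
Proof.
apply: (@derive_ge0_homo _ (fun x => mills x + x * dmills x)) => x.
  have dm (m : R -> R) (dm : R) : is_derive x 1 m dm ->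
      is_derive x 1 (fun x => 1 + x * m x) (m x + x * dm).
    by move=> ?; apply: is_derive_eq; rewrite /GRing.scale /=; ring.
  exact/dm/is_derive_mills.
rewrite -(pmulr_lge0 _ (phi_gt0 x)) /dmills.
have -> : (mills x + x * (1 + x * mills x)) * phi x =
  (1 + x ^+ 2) * (mills x * phi x) + x * phi x by ring.
by rewrite mills_phi.
Qed.

Lemma mills_increment (x y : R) : x <= y ->
  (y - x) * dmills x <= mills y - mills x <= (y - x) * dmills y.
Proof.
move=> xy.
have [t + ->] : exists2 t, t \in `[x, y]%R &
    mills y - mills x = dmills t * (y - x).
  apply: MVT_segment => // t.
  apply: (continuous_subspaceT) => {}t.
  exact/differentiable_continuous/derivable1_diffP/(@ex_derive _ _ _ _ _ _ _ (is_derive_mills t)).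
rewrite in_itv/= => /andP[xt ty]; rewrite !(mulrC (y - x)).
have yx : 0 <= y - x by rewrite subr_ge0.
by apply/andP; split; apply: ler_wpM2r => //; apply: dmills_homo.
Qed.

End mills_ratio.

(** * The Stein solution for the indicator of a half-line *)

Section normal_stein_equation.
Context {R : realType}.
Local Notation phi0 := (normal_peak (1 : R)).

Let peak_gt0 : 0 < phi0. Proof. exact: normal_peak_gt0. Qed.

Let pdfE (x : R) : normal_pdf 0 1 x = phi0 * expR (- (x ^+ 2) / 2).
Proof.
by rewrite normal_pdfE// /normal_fun subr0 expr1n -[1 *+ 2]/(2%:R).
Qed.

Lemma is_derive_Phi (x : R) :
  is_derive x 1 (@Phi R) (phi0 * expR (- (x ^+ 2) / 2)).
Proof.
have [d1 d2] := @continuous_FTC1 R (normal_pdf 0 1) -oo%O x (x + 1)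
  ltac:(by rewrite ltrDl)
  ltac:(by apply: (integrableS _ _ (@classical_sets.subsetT _ _)) => //;
           exact: integrable_normal_pdf)
  ltac:(by rewrite ltNyr)
  ltac:(by apply: continuous_normal_pdf; exact: oner_neq0).
rewrite -pdfE; apply: DeriveDef; first exact: d1.
by rewrite -derive1E.
Qed.

Lemma Phi_fin (x : R) : (normal_prob (0 : R) 1 `]-oo, x]%classic = (Phi x)%:E)%E.
Proof. by rewrite /Phi fineK// fin_num_measure. Qed.

Lemma Phi_ge0 (x : R) : 0 <= Phi x.
Proof. by rewrite /Phi fine_ge0. Qed.

Lemma Phi_le1 (x : R) : Phi x <= 1.
Proof. by rewrite -lee_fin -Phi_fin probability_le1. Qed.

(** [Phi] is the distribution function of the identity under the normal law, which gives its limits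
    at both infinities. *)
Let idTR : measurableTypeR R -> R := idfun.

#[local] HB.instance Definition _ :=
  @isMeasurableFun.Build _ _ _ _ idTR (@measurable_id _ _ classical_sets.setT).

Lemma Phi_near_Ny (e w : R) : 0 < e -> exists2 y, y <= w & Phi y < e.
Proof.
move=> e0.
have /fine_cvgP[_ h] := @cvg_cdfNy0 _ _ R (normal_prob (0 : R) 1) idTR.
have /cvgrPdist_lt /(_ _ e0) := h.
move=> h2.
near (ninfty_nbhs R) => y; exists y.
  by near: y; apply: nbhs_ninfty_le; rewrite num_real.
have : `|0 - Phi y| < e by near: y.
by rewrite sub0r normrN ger0_norm// Phi_ge0.
Unshelve. all: by end_near. Qed.

Lemma Phi_near_y (e w : R) : 0 < e -> exists2 y, w <= y & 1 - Phi y < e.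
Proof.
move=> e0.
have /fine_cvgP[_ h] := @cvg_cdfy1 _ _ R (normal_prob (0 : R) 1) idTR.
have /cvgrPdist_lt /(_ _ e0) := h.
move=> h2.
near (pinfty_nbhs R) => y; exists y.
  by near: y; apply: nbhs_pinfty_ge; rewrite num_real.
have : `|1 - Phi y| < e by near: y.
by rewrite ger0_norm// subr_ge0 Phi_le1.
Unshelve. all: by end_near. Qed.

(** The upper tail read from right to left: a second instance of [F], with the same derivative as
    [Phi]. *)
Let Psi (x : R) : R := 1 - Phi (- x).

Let Psi_ge0 x : 0 <= Psi x. Proof. by rewrite subr_ge0 Phi_le1. Qed.

Let is_derive_Psi (x : R) : is_derive x 1 Psi (phi0 * expR (- (x ^+ 2) / 2)).
Proof.
have dPhi := is_derive_Phi (- x).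
have dN : is_derive x 1 (fun x : R => - x) (- 1 : R) by apply: is_derive_eq.
have dc := @is_derive1_comp _ (@Phi R) (fun x : R => - x) x _ _ dPhi dN.
have := is_deriveB (is_derive_cst (1 : R) x (1 : R)) dc.
move=> /is_derive_eq; apply.
by rewrite sqrrN; ring.
Qed.

Let Psi_near_Ny (e w : R) : 0 < e -> exists2 y, y <= w & Psi y < e.
Proof.
move=> e0; have [y wy ye] := Phi_near_y e (- w) e0.
by exists (- y); rewrite ?/Psi ?opprK// lerNl.
Qed.

(* The two branches of the Stein solution for the indicator of ]-oo, z] are
   multiples of Mills ratios, of [Phi] and of its reflection. *)
Definition stein_sol (z w : R) : R :=
  if w <= z then mills phi0 Phi w * (1 - Phi z)
  else mills phi0 (fun x => 1 - Phi (- x)) (- w) * Phi z.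

(** At [w = z] both branches, multiplied by the density, give [Phi z * (1 - Phi z)]. The right-hand
    formula thus holds on the closed half-line, and arguments on the two sides can be glued at
    [z]. *)
Let stein_right (z w : R) : z <= w ->
  stein_sol z w = mills phi0 Psi (- w) * Phi z.
Proof.
rewrite le_eqVlt => /predU1P[<-|]; last first.
  by rewrite /stein_sol ltNge => /negbTE ->.
rewrite /stein_sol lexx.
have p0 : 0 < phi0 * expR (- (z ^+ 2) / 2) by rewrite mulr_gt0 ?expR_gt0.
apply: (mulIf (lt0r_neq0 p0)).
have h1 := mills_phi phi0 Phi peak_gt0 z.
have h2 := mills_phi phi0 Psi peak_gt0 (- z).
rewrite /= sqrrN in h2; rewrite /= in h1.
transitivity ((1 - Phi z) * Phi z).
  by rewrite -[X in _ = _ * X]h1; ring.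
transitivity (Psi (- z) * Phi z); first by rewrite /Psi opprK.
by rewrite -h2; ring.
Qed.

Let stein_left (z w : R) : w <= z ->
  stein_sol z w = mills phi0 Phi w * (1 - Phi z).
Proof. by rewrite /stein_sol => ->. Qed.

Let steinG (z w : R) := w * stein_sol z w.

Let steinG_left (z w : R) : w <= z ->
  steinG z w = (dmills phi0 Phi w - 1) * (1 - Phi z).
Proof. by move=> wz; rewrite /steinG stein_left// /dmills; ring. Qed.

Let steinG_right (z w : R) : z <= w ->
  steinG z w = (1 - dmills phi0 Psi (- w)) * Phi z.
Proof. by move=> wz; rewrite /steinG stein_right// /dmills; ring. Qed.

(** On each side of [z] the function is a nondecreasing affine image of [dmills], taken at [w] or,
    with reversed sign, at [- w]. *)
Lemma mul_stein_sol_homo (z : R) :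
  {homo (fun w => w * stein_sol z w) : x y / x <= y}.
Proof.
have hl x y : x <= y -> y <= z -> steinG z x <= steinG z y.
  move=> xy yz; rewrite !steinG_left//; last exact: le_trans yz.
  rewrite ler_wpM2r ?subr_ge0 ?Phi_le1// lerB//.
  exact: (dmills_homo _ _ peak_gt0 is_derive_Phi Phi_ge0 Phi_near_Ny).
have hr x y : x <= y -> z <= x -> steinG z x <= steinG z y.
  move=> xy zx; rewrite !steinG_right//; last exact: le_trans xy.
  rewrite ler_wpM2r ?Phi_ge0// lerB//.
  apply: (dmills_homo _ _ peak_gt0 is_derive_Psi Psi_ge0 Psi_near_Ny).
  by rewrite lerN2.
move=> x y xy; rewrite -!/(steinG z _).
have [yz|zy] := leP y z; first exact: hl.
have [zx|xz] := leP z x; first exact: hr.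
exact: (le_trans (hl _ _ (ltW xz) (lexx z)) (hr _ _ (ltW zy) (lexx z))).
Qed.

(** Nonnegativity of [dmills] gives the lower bound on the left of [z] and the upper bound on its
    right; monotonicity carries each across [z]. *)
Lemma mul_stein_sol_bounds (z w : R) :
  Phi z - 1 <= w * stein_sol z w <= Phi z.
Proof.
have hl x : x <= z -> Phi z - 1 <= steinG z x.
  move=> xz; rewrite steinG_left//.
  have d0 := dmills_ge0 _ _ peak_gt0 is_derive_Phi Phi_ge0 Phi_near_Ny x.
  have : 0 <= dmills phi0 Phi x * (1 - Phi z).
    by rewrite mulr_ge0// subr_ge0 Phi_le1.
  lra.
have hr x : z <= x -> steinG z x <= Phi z.
  move=> zx; rewrite steinG_right//.
  have d0 := dmills_ge0 _ _ peak_gt0 is_derive_Psi Psi_ge0 Psi_near_Ny (- x).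
  have : 0 <= dmills phi0 Psi (- x) * Phi z by rewrite mulr_ge0// Phi_ge0.
  lra.
have mono := mul_stein_sol_homo z.
rewrite -!/(steinG z _); have [wz|zw] := leP w z.
  by rewrite hl//=; apply: (le_trans (mono _ _ wz)); exact: (hr z (lexx z)).
apply/andP; split; last exact/hr/ltW.
by apply: (le_trans (hl z (lexx z))); exact/mono/ltW.
Qed.

(* [F] is a primitive of the nondecreasing function [w * stein_sol z w]. *)
Let stein_increment (z x y : R) (F : R -> R) :
  F = (fun w => stein_sol z w - Num.min w z + Phi z * w) -> x <= y ->
  (y - x) * steinG z x <= F y - F x <= (y - x) * steinG z y.
Proof.
move=> FE xy.
have := @mul_stein_sol_homo z; rewrite -/(steinG z) => mono.
have hl u v : u <= v -> v <= z ->
    (v - u) * steinG z u <= F v - F u <= (v - u) * steinG z v.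
  move=> uv vz; have uz := le_trans uv vz.
  rewrite FE !steinG_left// !stein_left// !min_l//.
  have [p1 p2] := andP (mills_increment _ _ peak_gt0 is_derive_Phi Phi_ge0
    Phi_near_Ny _ _ uv).
  have q0 : 0 <= 1 - Phi z by rewrite subr_ge0 Phi_le1.
  have := ler_wpM2r q0 p1; have := ler_wpM2r q0 p2; lra.
have hr u v : u <= v -> z <= u ->
    (v - u) * steinG z u <= F v - F u <= (v - u) * steinG z v.
  move=> uv zu; have zv := le_trans zu uv.
  rewrite FE !steinG_right// !stein_right// !min_r//.
  have vu : - v <= - u by rewrite lerN2.
  have [p1 p2] := andP (mills_increment _ _ peak_gt0 is_derive_Psi Psi_ge0
    Psi_near_Ny _ _ vu).
  have := ler_wpM2r (Phi_ge0 z) p1; have := ler_wpM2r (Phi_ge0 z) p2; lra.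
have [yz|/ltW zy] := leP y z; first exact: hl.
have [zx|/ltW xz] := leP z x; first exact: hr.
have [p1 p2] := andP (hl _ _ xz (lexx z)).
have [p3 p4] := andP (hr _ _ zy (lexx z)).
have q1 : 0 <= y - z by rewrite subr_ge0.
have q2 : 0 <= z - x by rewrite subr_ge0.
have := ler_wpM2l q1 (mono _ _ xz); have := ler_wpM2l q2 (mono _ _ zy).
lra.
Qed.

(** By the Stein equation the derivative of the solution is [u * stein_sol z u] plus the indicator
    of [u <= z] minus [Phi z]. On the interval of radius [e] around [w] the first term varies at
    most by its increment between the endpoints, and the indicator varies only if [z] lies in the
    interval. *)
Lemma stein_sol_osc (z w x y e : R) : `|x - w| <= e -> `|y - w| <= e ->
  `|(x - y) * (stein_sol z x - stein_sol z y) - (x - y) ^+ 2 *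
     (w * stein_sol z w + (w <= z)%R%:R - Phi z)| <=
  (x - y) ^+ 2 * ((w + e) * stein_sol z (w + e) -
                  (w - e) * stein_sol z (w - e) + (`|w - z| <= e)%R%:R).
Proof.
wlog yx : x y / y <= x.
  move=> H xe ye; have [|/ltW xy] := leP y x; first by move/H; exact.
  have E1 : (x - y) * (stein_sol z x - stein_sol z y) =
    (y - x) * (stein_sol z y - stein_sol z x) by ring.
  have E2 : (x - y) ^+ 2 = (y - x) ^+ 2 by ring.
  by rewrite E1 E2; exact: H.
move=> xe ye.
have [p1 p2] := andP (stein_increment z y x _ erefl yx).
have mono := mul_stein_sol_homo z.
have := mono (w - e) y; have := mono x (w + e).
have := mono w (w + e); have := mono (w - e) w.
rewrite -!/(steinG z _) /=.
have e0 : 0 <= e by exact: le_trans ye.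
have [xe1 xe2] : w - e <= x /\ x <= w + e by move: xe; rewrite ler_norml; lra.
have [ye1 ye2] : w - e <= y /\ y <= w + e by move: ye; rewrite ler_norml; lra.
move=> /(_ ltac:(lra)) m1 /(_ ltac:(lra)) m2 /(_ xe2) m3 /(_ ye1) m4.
have d0 : 0 <= x - y by rewrite subr_ge0.
set I := (w <= z)%R%:R; set J := (`|w - z| <= e)%R%:R.
(* [Num.min u z] is a primitive of the indicator of [u <= z]. *)
have mid : `|Num.min x z - Num.min y z - (x - y) * I| <= (x - y) * J.
  rewrite /I /J; have [wz|wz] := leP `|w - z| e.
    rewrite mulr1.
    have : 0 <= Num.min x z - Num.min y z <= x - y.
      by rewrite !minEle; case: ifPn => ?; case: ifPn => ?; lra.
    by rewrite ler_norml; case: (w <= z); rewrite ?mulr1 ?mulr0; lra.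
  rewrite mulr0 normr_le0.
  move: wz; rewrite lter_normr => /orP[wz|wz].
    rewrite !min_r; [|lra|lra].
    rewrite leNgt (_ : z < w); [|lra].
    by rewrite mulr0 !subr0 subrr.
  rewrite !min_l; [|lra|lra].
  rewrite (_ : w <= z); [|lra].
  by rewrite mulr1 subrr.
rewrite expr2 -!mulrA -mulrBr normrM (ger0_norm d0) ler_wpM2l//.
have a1 := ler_wpM2l d0 m1; have a2 := ler_wpM2l d0 m2.
have a3 := ler_wpM2l d0 m3; have a4 := ler_wpM2l d0 m4.
move: mid p1 p2; rewrite !ler_norml -/(steinG z _).
move: (stein_sol z x) (stein_sol z y) => fx fy.
move=> /andP[q1 q2] p1 p2.
lra.
Qed.

End normal_stein_equation.

(** * Averages over permutations and Stein's identity *)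

Section perm_average.
Context {R : realFieldType} {T : finType}.
Implicit Types (G : {set T}) (s t : {perm T}) (h : {perm T} -> R).

(** Permutations of [G] are taken as permutations of [T] that fix the complement of [G], so that
    conditioning and induction on [G] stay within one type. *)
Definition pavg G h : R :=
  (#|G| `!%:R)^-1 * \sum_(s : {perm T} | perm_on G s) h s.

Let fact_neq0 G : (#|G| `!%:R : R) != 0.
Proof. by rewrite pnatr_eq0 -lt0n fact_gt0. Qed.

Lemma eq_pavg G h1 h2 : (forall s, perm_on G s -> h1 s = h2 s) ->
  pavg G h1 = pavg G h2.
Proof. by move=> h12; congr (_ * _); exact: eq_bigr. Qed.

Lemma pavg_cst G (c : R) : pavg G (fun=> c) = c.
Proof.
rewrite /pavg sumr_const card_perm -[c *+ _]mulr_natl mulrA.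
by rewrite mulVf ?mul1r.
Qed.

Lemma pavgD G h1 h2 : pavg G (fun s => h1 s + h2 s) = pavg G h1 + pavg G h2.
Proof. by rewrite /pavg big_split mulrDr. Qed.

Lemma pavgZ G (c : R) h : pavg G (fun s => c * h s) = c * pavg G h.
Proof. by rewrite /pavg -mulr_sumr mulrCA. Qed.

Lemma pavgB G h1 h2 : pavg G (fun s => h1 s - h2 s) = pavg G h1 - pavg G h2.
Proof. by rewrite /pavg sumrB mulrBr. Qed.

Lemma pavg_sum G (I : Type) (r : seq I) (P : pred I) (F : I -> {perm T} -> R) :
  pavg G (fun s => \sum_(i <- r | P i) F i s) =
  \sum_(i <- r | P i) pavg G (F i).
Proof. by rewrite /pavg exchange_big mulr_sumr. Qed.

Lemma ler_pavg G h1 h2 : (forall s, perm_on G s -> h1 s <= h2 s) ->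
  pavg G h1 <= pavg G h2.
Proof.
by move=> h12; rewrite /pavg ler_wpM2l ?invr_ge0 ?ler0n//; exact: ler_sum.
Qed.

Lemma pavg_ge0 G h : (forall s, perm_on G s -> 0 <= h s) -> 0 <= pavg G h.
Proof. by move=> h0; rewrite -(pavg_cst G 0); exact: ler_pavg. Qed.

Lemma pavg_norm G h : `|pavg G h| <= pavg G (fun s => `|h s|).
Proof.
rewrite ler_norml -mulN1r -pavgZ; apply/andP; split; apply: ler_pavg => s _.
  by rewrite mulN1r lerNl -normrN ler_norm.
exact: ler_norm.
Qed.

Lemma pavg_sqr_le G h : pavg G h ^+ 2 <= pavg G (fun s => h s ^+ 2).
Proof.
set a := pavg G h.
have : 0 <= pavg G (fun s => (h s - a) ^+ 2) by apply: pavg_ge0 => s _; exact: sqr_ge0.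
rewrite (@eq_pavg _ _ (fun s => (h s ^+ 2 - (2 * a) * h s) + a ^+ 2)); last by move=> s _; ring.
rewrite pavgD pavg_cst pavgB pavgZ -/a; lra.
Qed.

Lemma pavg_mull G t h : perm_on G t -> pavg G (fun s => h (t * s)%g) = pavg G h.
Proof.
move=> Gt; congr (_ * _).
rewrite [RHS](reindex_inj (mulgI t)) /=; apply: eq_bigl => s.
apply/idP/idP => Gs; first exact: perm_onM.
by rewrite -(mulKg t s); apply: perm_onM => //; exact: perm_onV.
Qed.

Lemma perm_onT s : perm_on [set: T] s.
Proof. by apply/subsetP => x _; rewrite inE. Qed.

Lemma tperm_perm_on G i j : i \in G -> j \in G -> perm_on G (tperm i j).
Proof.
move=> iG jG; apply: (subset_trans (tperm_on i j)).
by apply/subsetP => x; rewrite !inE => /orP[] /eqP ->.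
Qed.

Lemma reindex_perm_on G s (F : T -> R) : perm_on G s ->
  \sum_(i in G) F (s i) = \sum_(i in G) F i.
Proof.
move=> Gs; rewrite [RHS](reindex_inj (@perm_inj _ s)) /=.
by apply: eq_bigl => i; rewrite perm_closed.
Qed.

(** The average is the same for every pair of distinct points, by invariance under translation, and
    the sum over all pairs is constant in [s]. Since [h] vanishes on the diagonal, the full double
    sum may be used. *)
Lemma pavg_pair G i j (h : T -> T -> R) : i \in G -> j \in G -> i != j ->
  (forall k, h k k = 0) ->
  pavg G (fun s => h (s i) (s j)) =
  (#|G|%:R * (#|G|%:R - 1))^-1 * \sum_(k in G) \sum_(l in G) h k l.
Proof.
move=> iG jG ij h0.
have ind i' j' : i' \in G -> j' \in G -> i' != j' ->
    pavg G (fun s => h (s i') (s j')) = pavg G (fun s => h (s i) (s j)).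
  move=> iG' jG' ij'.
  (* [t] sends [i] to [i'] and [j] to [j']. *)
  pose u := tperm i i'; pose t := (u * tperm (u j) j')%g.
  have uG : u j \in G by rewrite /u perm_closed// tperm_perm_on.
  have Gt : perm_on G t by apply: perm_onM; exact: tperm_perm_on.
  rewrite -(pavg_mull G t (fun s => h (s i) (s j)) Gt); apply: eq_pavg => s _.
  have ui : u i = i' by rewrite /u tpermL.
  rewrite /t !permM ui tpermL tpermD// 1?eq_sym//.
  by rewrite -[X in X != _]ui (inj_eq perm_inj).
have m1 : (1 < #|G|)%N by apply/card_gt1P; exists i, j.
have mN0 : #|G|%:R * (#|G|%:R - 1) != 0 :> R.
  rewrite mulf_neq0 ?pnatr_eq0 -?lt0n ?(ltnW m1)//.
  by rewrite subr_eq0 pnatr_eq1 gtn_eqF.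
apply: (mulfI mN0); rewrite mulVKf//.
transitivity (\sum_(k in G) \sum_(l in G) pavg G (fun s => h (s k) (s l))).
  transitivity (\sum_(k in G) (#|G|%:R - 1) * pavg G (fun s => h (s i) (s j))).
    by rewrite sumr_const -[RHS]mulr_natl [RHS]mulrA.
  apply: eq_bigr => k kG; rewrite (bigD1 k)//=.
  have -> : pavg G (fun s => h (s k) (s k)) = 0.
    by rewrite -[RHS](pavg_cst G); apply: eq_pavg => s _; exact: h0.
  rewrite add0r.
  rewrite (eq_bigr (fun=> pavg G (fun s => h (s i) (s j)))); last first.
    by move=> l /andP[lG lk]; apply: ind; rewrite // eq_sym.
  rewrite sumr_const -[RHS]mulr_natl; congr (_ * _).
  rewrite (cardsD1 k G) kG natrD /= addrC addKr; congr (_%:R).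
  by apply: eq_card => l; rewrite !inE andbC.
under eq_bigr do rewrite -pavg_sum.
rewrite -pavg_sum -[RHS](pavg_cst G); apply: eq_pavg => s Gs.
rewrite -(reindex_perm_on G s (fun k => \sum_(l in G) h k l))//.
by apply: eq_bigr => k _; rewrite (reindex_perm_on G s (h (s k))).
Qed.

Section stein_pair.
Variables (G : {set T}) (B : T -> T -> R).

Definition crossdiff (i j k l : T) : R := B i k - B j k - B i l + B j l.

Definition permstat (s : {perm T}) : R := \sum_(i in G) B i (s i).

Definition permstat_mean : R :=
  #|G|%:R^-1 * \sum_(i in G) \sum_(k in G) B i k.

Lemma permstat_swap s i j : i \in G -> j \in G ->
  permstat s - permstat (tperm i j * s)%g = crossdiff i j (s i) (s j).
Proof.
move=> iG jG; rewrite /crossdiff /permstat.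
have [<-|ij] := eqVneq i j.
  by rewrite tperm1 mul1g subrr; ring.
rewrite (bigD1 i)//= (bigD1 j) ?jG 1?eq_sym//=.
rewrite [X in _ - X](bigD1 i)//= [X in _ - (_ + X)](bigD1 j) ?jG 1?eq_sym//=.
rewrite !permM tpermL tpermR.
rewrite [X in _ - (_ + (_ + X))](eq_bigr (fun k => B k (s k))); last first.
  by move=> k /andP[/andP[_ ki] kj]; rewrite permM tpermD// eq_sym.
ring.
Qed.

(** The linear regression property of the exchangeable pair: on average a random transposition pulls
    the statistic towards its mean. *)
Lemma sum_permstat_swap s : perm_on G s -> (0 < #|G|)%N ->
  \sum_(i in G) \sum_(j in G) (permstat s - permstat (tperm i j * s)%g) =
  2 * #|G|%:R * (permstat s - permstat_mean).
Proof.
move=> Gs m0; rewrite /permstat_mean.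
have mN0 : (#|G|%:R : R) != 0 by rewrite pnatr_eq0 -lt0n.
rewrite mulrBr -!mulrA mulVKf// mulrA.
have E i : i \in G -> \sum_(j in G) (permstat s - permstat (tperm i j * s)%g) =
    #|G|%:R * B i (s i) - \sum_(j in G) B j (s i) - \sum_(j in G) B i j
    + permstat s.
  move=> iG; rewrite -(reindex_perm_on _ _ (B i) Gs) [X in _ = _ + X]/permstat.
  rewrite mulr_natl -sumr_const -!sumrB -big_split; apply: eq_bigr => j jG.
  by rewrite permstat_swap.
rewrite (eq_bigr _ E) big_split /= !sumrB -mulr_sumr -/(permstat s).
rewrite sumr_const -[X in _ + X]mulr_natl.
rewrite (reindex_perm_on _ _ (fun k => \sum_(j in G) B j k) Gs) exchange_big /=.
ring.
Qed.

(** Composition with [tperm i j] is a measure-preserving involution that changes the sign of the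
    increment; hence the increment times [f (permstat s)] averages to half the symmetrised product.
    Summation over [i] and [j] uses the regression property. *)
Lemma pavg_stein (f : R -> R) : (0 < #|G|)%N ->
  pavg G (fun s => (permstat s - permstat_mean) * f (permstat s)) =
  (4 * #|G|%:R)^-1 * \sum_(i in G) \sum_(j in G)
    pavg G (fun s => (permstat s - permstat (tperm i j * s)%g) *
                     (f (permstat s) - f (permstat (tperm i j * s)%g))).
Proof.
move=> m0; have mN0 : (#|G|%:R : R) != 0 by rewrite pnatr_eq0 -lt0n.
pose Y := permstat; pose Z i j s := Y (tperm i j * s)%g.
have E i j : i \in G -> j \in G ->
    pavg G (fun s => (Y s - Z i j s) * (f (Y s) - f (Z i j s))) =
    2 * pavg G (fun s => (Y s - Z i j s) * f (Y s)).
  move=> iG jG.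
  rewrite (eq_pavg _ _ (fun s => (Y s - Z i j s) * f (Y s)
     - (Y s - Z i j s) * f (Z i j s))); last by move=> s _; rewrite mulrBr.
  rewrite pavgB mulr_natl mulr2n; congr (_ + _).
  rewrite -(pavg_mull G (tperm i j)) ?tperm_perm_on//.
  rewrite -mulN1r -pavgZ; apply: eq_pavg => s _.
  rewrite /Z mulgA tperm2 mul1g; ring.
under eq_bigr => i iG.
  under eq_bigr => j jG do rewrite E//.
  rewrite -mulr_sumr -pavg_sum; over.
rewrite -mulr_sumr -pavg_sum.
rewrite (eq_pavg _ (fun s => \sum_(i in G) _)
  (fun s => 2 * #|G|%:R * ((Y s - permstat_mean) * f (Y s)))); last first.
  move=> s Gs; rewrite [RHS]mulrA -sum_permstat_swap// mulr_suml.
  by apply: eq_bigr => i _; rewrite mulr_suml.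
rewrite [in RHS]pavgZ; field; exact: mN0.
Qed.

Lemma sum_pavg_crossdiff (f : R -> R) : f 0 = 0 -> (1 < #|G|)%N ->
  \sum_(i in G) \sum_(j in G) pavg G (fun s => f (crossdiff i j (s i) (s j))) =
  (#|G|%:R * (#|G|%:R - 1))^-1 *
  \sum_(i in G) \sum_(j in G) \sum_(k in G) \sum_(l in G)
    f (crossdiff i j k l).
Proof.
move=> f0 m1.
rewrite mulr_sumr; apply: eq_bigr => i iG.
rewrite mulr_sumr; apply: eq_bigr => j jG.
have c0 k l : crossdiff i i k l = 0 by rewrite /crossdiff; ring.
have [<-|ij] := eqVneq i j.
  rewrite (eq_pavg _ _ (fun=> 0)) ?pavg_cst; last by move=> s _; rewrite c0.
  by rewrite big1 ?mulr0// => k _; rewrite big1// => l _; rewrite c0.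
rewrite (pavg_pair G i j (fun k l => f (crossdiff i j k l)))// => k.
by rewrite /crossdiff -[RHS]f0; congr f; ring.
Qed.

Lemma pavg_permstat : (0 < #|G|)%N -> pavg G permstat = permstat_mean.
Proof.
move=> m0; have := pavg_stein (fun=> 1) m0.
rewrite [X in _ = _ * X]big1 ?mulr0; last first.
  move=> i _; rewrite big1// => j _.
  by rewrite (eq_pavg _ _ (fun=> 0)) ?pavg_cst// => s _; rewrite subrr mulr0.
rewrite (eq_pavg _ _ (fun s => permstat s - permstat_mean)); last first.
  by move=> s _; rewrite mulr1.
by rewrite pavgB pavg_cst => /eqP; rewrite subr_eq0 => /eqP.
Qed.

Lemma permstat_var : (0 < #|G|)%N ->
  pavg G (fun s => (permstat s - permstat_mean) ^+ 2) =
  (4 * #|G|%:R)^-1 * \sum_(i in G) \sum_(j in G)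
    pavg G (fun s => crossdiff i j (s i) (s j) ^+ 2).
Proof.
move=> m0.
transitivity (pavg G (fun s => (permstat s - permstat_mean) * permstat s)
  - permstat_mean * pavg G (fun s => permstat s - permstat_mean)).
  by rewrite -pavgZ -pavgB; apply: eq_pavg => s _; ring.
rewrite (pavgB G permstat) pavg_cst pavg_permstat// subrr mulr0 subr0.
rewrite (pavg_stein id m0).
congr (_ * _); apply: eq_bigr => i iG; apply: eq_bigr => j jG.
by apply: eq_pavg => s _; rewrite permstat_swap// expr2.
Qed.

End stein_pair.

End perm_average.

(** * The Efron-Stein inequality *)

Section efron_stein.
Context {R : realFieldType} {T : finType}.
Implicit Types (G : {set T}) (s : {perm T}) (F : {perm T} -> R).

Definition pvar G F : R := pavg G (fun s => F s ^+ 2) - pavg G F ^+ 2.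

Lemma pvarE G F : pvar G F = pavg G (fun s => (F s - pavg G F) ^+ 2).
Proof.
set a := pavg G F.
rewrite (eq_pavg _ _ (fun s => (F s ^+ 2 - (2 * a) * F s) + a ^+ 2)); last first.
  by move=> s _; ring.
rewrite pavgD pavg_cst pavgB pavgZ -/a /pvar -/a; ring.
Qed.

(** Right multiplication by [tperm i r] maps the permutations of [G] fixing [i] onto those sending
    [i] to [r]. *)
Let sum_perm_on_fibre G i r F : i \in G -> r \in G ->
  \sum_(s | perm_on G s && (s i == r)) F s =
  \sum_(s | perm_on (G :\ i) s) F (s * tperm i r)%g.
Proof.
move=> iG rG; rewrite (reindex_inj (mulIg (tperm i r))) /=.
apply: eq_bigl => s; apply/andP/idP => [[Gs /eqP si]|Gs].
  have {}si : s i = i.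
    by apply: (@perm_inj _ (tperm i r)); rewrite -permM si tpermL.
  apply/subsetP => x; rewrite !inE => sx; apply/andP; split.
    by apply: contraNneq sx => ->; rewrite si.
  have : perm_on G (s * tperm i r * tperm i r)%g.
    by apply: perm_onM => //; exact: tperm_perm_on.
  by rewrite -mulgA tperm2 mulg1 => /subsetP; apply; rewrite inE.
have si : s i = i by apply: (out_perm Gs); rewrite !inE eqxx.
split; last by rewrite permM si tpermL.
apply: perm_onM; last exact: tperm_perm_on.
by apply: (subset_trans Gs); exact: subsetDl.
Qed.

Lemma pavg_fibre G i F : i \in G ->
  pavg G F = #|G|%:R^-1 *
    \sum_(r in G) pavg (G :\ i) (fun s => F (s * tperm i r)%g).
Proof.
move=> iG; rewrite /pavg -mulr_sumr mulrA.
rewrite {1}(cardsD1 i G) iG add1n factS natrM invfM.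
rewrite [in RHS](cardsD1 i G) iG add1n; congr (_ * _).
rewrite (partition_big (fun s => s i) (mem G)) /=; last first.
  by move=> s Gs; rewrite perm_closed.
by apply: eq_bigr => r rG; exact: sum_perm_on_fibre.
Qed.

Let pavg_fibre_tperm G i r t F : i \in G -> r \in G -> t \in G ->
  pavg (G :\ i) (fun s => F (s * tperm i t)%g) =
  pavg (G :\ i) (fun s => F (s * tperm i r * tperm r t)%g).
Proof.
move=> iG rG tG; rewrite /pavg -!sum_perm_on_fibre//; congr (_ * _).
rewrite -(sum_perm_on_fibre G i r (fun s => F (s * tperm r t)%g))//.
rewrite (reindex_inj (mulIg (tperm r t))) /=; apply: eq_bigl => s.
rewrite permM -[X in _ == X](tpermL r t) (inj_eq perm_inj); congr (_ && _).
have Gt := tperm_perm_on G r t rG tG.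
apply/idP/idP => Gs; last exact: perm_onM.
by rewrite -(mulgK (tperm r t) s); apply: perm_onM => //; exact: perm_onV.
Qed.

Let energy G F i j := pavg G (fun s => (F s - F (tperm i j * s)%g) ^+ 2).

(** The variance of the fibre means is half their mean squared difference over pairs of fibres.
    Exchanging the values [r] and [t] couples the two fibres, and Jensen's inequality moves the
    square inside. *)
Let var_fibre_means G i F : i \in G ->
  let h r := pavg (G :\ i) (fun s => F (s * tperm i r)%g) in
  #|G|%:R^-1 * (\sum_(r in G) h r ^+ 2) -
    (#|G|%:R^-1 * \sum_(r in G) h r) ^+ 2 <=
  (2 * #|G|%:R)^-1 * \sum_(j in G) energy G F i j.
Proof.
move=> iG /=.
have m0 : (0 < #|G|)%N by rewrite card_gt0; apply/set0Pn; exists i.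
have mN0 : (#|G|%:R : R) != 0 by rewrite pnatr_eq0 -lt0n.
have Evar (h : T -> R) : #|G|%:R^-1 * (\sum_(r in G) h r ^+ 2) -
    (#|G|%:R^-1 * \sum_(r in G) h r) ^+ 2 =
  (2 * #|G|%:R ^+ 2)^-1 * \sum_(t in G) \sum_(r in G) (h r - h t) ^+ 2.
  have E t : \sum_(r in G) (h r - h t) ^+ 2 = \sum_(r in G) h r ^+ 2
      - 2 * (\sum_(r in G) h r) * h t + #|G|%:R * h t ^+ 2.
    rewrite [#|G|%:R * _]mulr_natl -sumr_const mulr_sumr mulr_suml -sumrB -big_split.
    by apply: eq_bigr => r _ /=; ring.
  rewrite (eq_bigr _ (fun t _ => E t)) big_split /= sumrB -!mulr_sumr.
  by rewrite sumr_const -[X in _ * (X - _ + _)]mulr_natl; field.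
rewrite Evar.
pose H t s := (F s - F (s * tperm (s i) t)%g) ^+ 2.
apply: (@le_trans _ _ ((2 * #|G|%:R ^+ 2)^-1 *
    \sum_(t in G) (#|G|%:R * pavg G (H t)))).
  rewrite ler_wpM2l ?invr_ge0 ?mulr_ge0 ?exprn_ge0//.
  apply: ler_sum => t tG; rewrite [X in _ <= _ * X](pavg_fibre G i)// mulrA divff// mul1r.
  apply: ler_sum => r rG; rewrite (pavg_fibre_tperm G i r t)// -pavgB.
  apply: le_trans (pavg_sqr_le _ _) _; apply: ler_pavg => s Gs.
  by rewrite /H permM (out_perm Gs) ?tpermL// !inE eqxx.
rewrite -mulr_sumr -pavg_sum.
rewrite (eq_pavg _ _ (fun s => \sum_(j in G) (F s - F (tperm i j * s)%g) ^+ 2)).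
  rewrite pavg_sum mulrA le_eqVlt; apply/orP; left; apply/eqP.
  by congr (_ * _); field; exact: mN0.
(* With [t = s j], exchanging the values [s i] and [t] is exchanging the positions [i] and [j]. *)
move=> s Gs; rewrite -(reindex_perm_on G s _ Gs); apply: eq_bigr => j _.
by rewrite /H -tpermJ conjgE !mulgA mulgV mul1g.
Qed.

(* Condition on the image of a point [i], then average the resulting bound over
   [i]: the averaging is what makes the constant of order [1 / #|G|]. *)
Lemma efron_stein G F :
  pvar G F <= (2 * #|G|%:R)^-1 * \sum_(i in G) \sum_(j in G)
    pavg G (fun s => (F s - F (tperm i j * s)%g) ^+ 2).
Proof.
have [m] := ubnP #|G|; elim: m G F => // m IH G F; rewrite ltnS => Gm.
rewrite -/(energy G F); set S := \sum_(i in G) _.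
have [G0|] := eqVneq G set0.
  have E s : perm_on G s -> F s = F 1%g.
    by move=> Gs; rewrite (perm_on_id Gs)// G0 cards0.
  rewrite pvarE (eq_pavg _ _ (fun=> 0)) ?pavg_cst.
    by rewrite /S G0 big_set0 mulr0.
  move=> s Gs; rewrite (eq_pavg _ F (fun=> F 1%g))// pavg_cst E// subrr.
  by rewrite expr0n.
rewrite -card_gt0 => m0.
have mN0 : (#|G|%:R : R) != 0 by rewrite pnatr_eq0 -lt0n.
have mR : 0 < (#|G|%:R : R) by rewrite ltr0n.
pose c i := \sum_(j in G) energy G F i j.
have eC i j : energy G F i j = energy G F j i by rewrite /energy tpermC.
have e0 i : energy G F i i = 0.
  rewrite /energy (eq_pavg _ _ (fun=> 0)) ?pavg_cst// => s _.
  by rewrite tperm1 mul1g subrr expr0n.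
have step i : i \in G -> pvar G F <=
    (2 * (#|G|%:R - 1))^-1 * (S - 2 * c i) + (2 * #|G|%:R)^-1 * c i.
  move=> iG.
  pose Fr r s := F (s * tperm i r)%g.
  have Gi : #|G| = #|G :\ i|.+1 by rewrite (cardsD1 i G) iG.
  (* Law of total variance: the within-fibre part is left to the induction hypothesis, the
     between-fibre part to [var_fibre_means]. *)
  have -> : pvar G F = #|G|%:R^-1 * (\sum_(r in G) pvar (G :\ i) (Fr r)) +
    (#|G|%:R^-1 * (\sum_(r in G) pavg (G :\ i) (Fr r) ^+ 2) -
     (#|G|%:R^-1 * \sum_(r in G) pavg (G :\ i) (Fr r)) ^+ 2).
    rewrite /pvar (pavg_fibre G i F)// (pavg_fibre G i (fun s => F s ^+ 2))//.
    by rewrite sumrB; ring.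
  apply: lerD; last exact: var_fibre_means.
  (* Row and column [i] each contribute [c i], the diagonal entry being 0. *)
  have -> : S - 2 * c i = \sum_(j in G :\ i) \sum_(k in G :\ i) energy G F j k.
    rewrite /S (bigD1 i)//= -/(c i).
    have -> : \sum_(j in G | j != i) \sum_(k in G) energy G F j k =
       \sum_(j in G | j != i) energy G F j i +
       \sum_(j in G :\ i) \sum_(k in G :\ i) energy G F j k.
      rewrite [X in _ + X](eq_bigl (fun j => (j \in G) && (j != i))); last first.
        by move=> j; rewrite !inE andbC.
      rewrite -big_split; apply: eq_bigr => j _ /=; rewrite (bigD1 i)//=.
      by congr (_ + _); apply: eq_bigl => k; rewrite !inE andbC.
    have -> : \sum_(j in G | j != i) energy G F j i = c i.
      rewrite /c [RHS](bigD1 i)//= e0 add0r; apply: eq_bigr => j _; exact: eC.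
    by ring.
  have -> : \sum_(j in G :\ i) \sum_(k in G :\ i) energy G F j k =
     #|G|%:R^-1 * \sum_(r in G) \sum_(j in G :\ i) \sum_(k in G :\ i)
       energy (G :\ i) (Fr r) j k.
    rewrite [in RHS]exchange_big mulr_sumr; apply: eq_bigr => j _.
    rewrite [in RHS]exchange_big mulr_sumr; apply: eq_bigr => k _ /=.
    rewrite /energy (pavg_fibre G i)//; congr (_ * _); apply: eq_bigr => r _.
    by apply: eq_pavg => s _; rewrite /Fr !mulgA.
  rewrite mulrCA ler_wpM2l ?invr_ge0// mulr_sumr; apply: ler_sum => r rG.
  apply: (le_trans (IH (G :\ i) (Fr r) _)); first by rewrite -ltnS -Gi.
  suff -> : #|G|%:R - 1 = #|G :\ i|%:R :> R by [].
  by rewrite Gi -(natr1 #|G :\ i|) addrK.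
have S0 : 0 <= S.
  apply: sumr_ge0 => i _; apply: sumr_ge0 => j _; apply: pavg_ge0 => s _.
  exact: sqr_ge0.
have : \sum_(i in G) pvar G F <= \sum_(i in G)
    ((2 * (#|G|%:R - 1))^-1 * (S - 2 * c i) + (2 * #|G|%:R)^-1 * c i).
  by apply: ler_sum => i iG; exact: step.
have -> : \sum_(i in G)
    ((2 * (#|G|%:R - 1))^-1 * (S - 2 * c i) + (2 * #|G|%:R)^-1 * c i) =
  (2 * (#|G|%:R - 1))^-1 * (S *+ #|G| - 2 * S) + (2 * #|G|%:R)^-1 * S.
  have Sc : \sum_(i in G) c i = S by [].
  rewrite big_split /=; congr (_ + _); last by rewrite -Sc mulr_sumr.
  rewrite -mulr_sumr; congr (_ * _).
  by rewrite -Sc mulr_sumr -sumr_const -sumrB.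
rewrite sumr_const.
rewrite -[pvar G F *+ _]mulr_natl -[S *+ _]mulr_natl => h.
rewrite -(ler_pM2l mR); apply: (le_trans h).
(* For a singleton the inverse of [#|G| - 1] is 0 by convention, and the remaining term suffices. *)
have [m1|m1] := leqP #|G| 1.
  have -> : #|G| = 1 by apply/eqP; rewrite eqn_leq m1.
  by rewrite subrr mulr0 invr0 mul0r add0r mul1r.
have mR1 : 0 < (#|G|%:R - 1 : R) by rewrite subr_gt0 ltr1n.
set M : R := #|G|%:R in mN0 mR mR1 *.
have -> : M * ((2 * M)^-1 * S) = (2 * (M - 1))^-1 * (M * S - 2 * S) +
   (2 * M)^-1 * S + S / (2 * M * (M - 1)).
  by field; rewrite mN0 gt_eqF.
rewrite lerDl divr_ge0// !mulr_ge0 ?ltW//.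
Qed.

End efron_stein.

(** * Concentration *)

Section concentration.
Context {R : realFieldType} {T : finType}.
Variables (G : {set T}) (B : T -> T -> R) (d : R).
Hypotheses (d_gt0 : 0 < d) (G_gt1 : (1 < #|G|)%N).

(** The square with linear growth beyond [d], as produced by [clamp_mul]. *)
Definition tsqr (u : R) : R := `|u| * Num.min `|u| d.

Lemma tsqr_ge0 u : 0 <= tsqr u.
Proof. by rewrite mulr_ge0// le_min normr_ge0 ltW. Qed.

Lemma tsqr0 : tsqr 0 = 0. Proof. by rewrite /tsqr normr0 mul0r. Qed.

Lemma tsqr_le u : tsqr u <= d * `|u|.
Proof. by rewrite /tsqr mulrC ler_wpM2r// ge_min lexx orbT. Qed.

Let w s i j := tsqr (crossdiff B i j (s i) (s j)).
Let Y := permstat G B.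
Let mu := permstat_mean G B.
Let m : R := #|G|%:R.
Let M (s : {perm T}) := (4 * m)^-1 * \sum_(i in G) \sum_(j in G) w s i j.

Let m_gt0 : 0 < m. Proof. by rewrite ltr0n ltnW. Qed.
Let m4_ge0 : 0 <= (4 * m)^-1. Proof. by rewrite invr_ge0 mulr_ge0// ltW. Qed.
Let m2_ge0 : 0 <= (2 * m)^-1. Proof. by rewrite invr_ge0 mulr_ge0// ltW. Qed.
Let w_ge0 s i j : 0 <= w s i j. Proof. exact: tsqr_ge0. Qed.
Let wC s i j : w s i j = w s j i.
Proof. by rewrite /w /crossdiff; congr tsqr; ring. Qed.

Let row s i := \sum_(j in G) w s i j.

(** A transposition of [i] and [j] changes only the terms [w s k l] with [k] or [l] among [i] and
    [j]. Rows and columns count equally by symmetry. *)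
Let M_swap_le s i j : i \in G -> j \in G ->
  `|M s - M (tperm i j * s)%g| <= (2 * m)^-1 *
    (row s i + row s j + row (tperm i j * s)%g i + row (tperm i j * s)%g j).
Proof.
move=> iG jG; set t := (tperm i j * s)%g.
pose ind k := (k == i)%:R + (k == j)%:R : R.
have ind_row s' : \sum_(k in G) \sum_(l in G) ind k * w s' k l = row s' i + row s' j.
  under eq_bigr do rewrite -mulr_sumr mulrDl.
  rewrite big_split /=; congr (_ + _).
    rewrite (bigD1 i)//= eqxx mul1r [X in _ + X]big1 ?addr0// => k /andP[_ /negbTE ->].
    by rewrite mul0r.
  rewrite (bigD1 j)//= eqxx mul1r [X in _ + X]big1 ?addr0// => k /andP[_ /negbTE ->].
  by rewrite mul0r.
have ind_col s' : \sum_(k in G) \sum_(l in G) ind l * w s' k l = row s' i + row s' j.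
  rewrite exchange_big /= -ind_row; apply: eq_bigr => l _; apply: eq_bigr => k _.
  by rewrite wC.
have h k l : k \in G -> l \in G ->
    `|w s k l - w t k l| <= (ind k + ind l) * (w s k l + w t k l).
  move=> kG lG; have wp := w_ge0 s k l; have wq := w_ge0 t k l.
  have w2 : `|w s k l - w t k l| <= w s k l + w t k l.
    by rewrite (le_trans (ler_normB _ _))// !ger0_norm.
  have i0 x : 0 <= ind x by rewrite addr_ge0.
  have i1 x : (x == i) || (x == j) -> 1 <= ind x.
    by rewrite /ind => /orP[] ->; rewrite ?lerDl ?lerDr.
  have [kij|] := boolP ((k == i) || (k == j)).
    apply: (le_trans w2); rewrite ler_peMl ?addr_ge0//.
    by rewrite (le_trans (i1 _ kij))// lerDl.
  have [lij _|] := boolP ((l == i) || (l == j)).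
    apply: (le_trans w2); rewrite ler_peMl ?addr_ge0//.
    by rewrite (le_trans (i1 _ lij))// lerDr.
  rewrite !negb_or => /andP[li lj] /andP[ki kj].
  rewrite [w t k l]/w !permM !tpermD 1?eq_sym// subrr normr0.
  by rewrite mulr_ge0 ?addr_ge0.
rewrite /M -mulrBr normrM (ger0_norm m4_ge0).
have -> : (2 * m)^-1 = (4 * m)^-1 * 2 by field; rewrite gt_eqF.
rewrite -[X in _ <= X]mulrA; apply: ler_wpM2l => //.
rewrite -sumrB; apply: (le_trans (ler_norm_sum _ _ _)).
apply: (@le_trans _ _ (\sum_(k in G) \sum_(l in G)
    (ind k * w s k l + ind k * w t k l + ind l * w s k l + ind l * w t k l))).
  apply: ler_sum => k kG; rewrite -sumrB; apply: (le_trans (ler_norm_sum _ _ _)).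
  apply: ler_sum => l lG; apply: (le_trans (h _ _ kG lG)).
  by rewrite le_eqVlt; apply/orP; left; apply/eqP; ring.
under eq_bigr do rewrite !big_split /=.
rewrite !big_split /= !ind_row !ind_col le_eqVlt; apply/orP; left; apply/eqP.
ring.
Qed.

(** Cauchy-Schwarz over [j] and [tsqr_le] reduce the squared rows to squared increments, whose sum
    is the variance by [permstat_var]. *)
Let sum_row_sqr :
  \sum_(i in G) pavg G (fun s => row s i ^+ 2) <=
  4 * m ^+ 2 * d ^+ 2 * pavg G (fun s => (Y s - mu) ^+ 2).
Proof.
rewrite [X in _ <= _ * X](permstat_var G B (ltnW G_gt1)) -/m.
have -> : 4 * m ^+ 2 * d ^+ 2 * ((4 * m)^-1 * (\sum_(i in G) \sum_(j in G)
    pavg G (fun s => crossdiff B i j (s i) (s j) ^+ 2))) =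
    \sum_(i in G) m * (d ^+ 2 * (\sum_(j in G)
    pavg G (fun s => crossdiff B i j (s i) (s j) ^+ 2))).
  by rewrite -!mulr_sumr; field; rewrite gt_eqF.
apply: ler_sum => i iG; rewrite -pavg_sum -!pavgZ; apply: ler_pavg => s _.
have cs (x : T -> R) : (\sum_(j in G) x j) ^+ 2 <= m * \sum_(j in G) x j ^+ 2.
  have : 0 <= \sum_(j in G) (m * x j - \sum_(k in G) x k) ^+ 2.
    by apply: sumr_ge0 => j _; exact: sqr_ge0.
  set S := \sum_(k in G) x k.
  have -> : \sum_(j in G) (m * x j - S) ^+ 2 =
      m * (m * \sum_(j in G) x j ^+ 2 - S ^+ 2).
    transitivity (\sum_(j in G) (m ^+ 2 * x j ^+ 2 - 2 * m * S * x j + S ^+ 2)).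
      by apply: eq_bigr => j _; ring.
    rewrite big_split sumrB -!mulr_sumr /= -/S sumr_const -[S *+ _]mulr_natl.
    by rewrite -/m; ring.
  by rewrite pmulr_rge0// subr_ge0.
apply: (le_trans (cs _)); apply: ler_wpM2l; first exact: ltW.
rewrite mulr_sumr.
apply: ler_sum => j jG; rewrite -[X in _ <= _ * X]real_normK ?num_real// -exprMn.
apply: lerXn2r; rewrite ?nnegrE; last exact: tsqr_le.
  exact: tsqr_ge0.
by rewrite mulr_ge0// ltW.
Qed.

Let var_M : pvar G M <= 8 * d ^+ 2 * pavg G (fun s => (Y s - mu) ^+ 2).
Proof.
apply: (le_trans (efron_stein _ _)).
pose al i := pavg G (fun s => row s i ^+ 2).
have h i j : i \in G -> j \in G ->
    pavg G (fun s => (M s - M (tperm i j * s)%g) ^+ 2) <=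
    2 * (m ^+ 2)^-1 * (al i + al j).
  move=> iG jG.
  have e k : pavg G (fun s => row (tperm i j * s)%g k ^+ 2) = al k.
    exact: (pavg_mull G (tperm i j) (fun s => row s k ^+ 2) (tperm_perm_on _ _ _ iG jG)).
  have -> : 2 * (m ^+ 2)^-1 * (al i + al j) = pavg G (fun s => (m ^+ 2)^-1 *
     (row s i ^+ 2 + row s j ^+ 2 + row (tperm i j * s)%g i ^+ 2
      + row (tperm i j * s)%g j ^+ 2)).
    by rewrite pavgZ !pavgD !e -/(al i) -/(al j); ring.
  apply: ler_pavg => s _.
  have row0 s' k : 0 <= row s' k by apply: sumr_ge0 => *; exact: w_ge0.
  have := M_swap_le s i j iG jG; set t := (tperm i j * s)%g.
  move: (row0 s i) (row0 s j) (row0 t i) (row0 t j).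
  set a := row s i; set b := row s j; set a' := row t i; set b' := row t j.
  move=> a0 b0 a0' b0' hM.
  rewrite -(@real_normK _ (M s - M t)) ?num_real//.
  apply: (@le_trans _ _ (((2 * m)^-1 * (a + b + a' + b')) ^+ 2)).
    by apply: lerXn2r; rewrite ?nnegrE// mulr_ge0// !addr_ge0.
  have -> : ((2 * m)^-1 * (a + b + a' + b')) ^+ 2 =
      (m ^+ 2)^-1 * ((a + b + a' + b') ^+ 2 / 4) by field; rewrite gt_eqF.
  apply: ler_wpM2l; first by rewrite invr_ge0 sqr_ge0.
  have := sqr_ge0 (a - b); have := sqr_ge0 (a - a'); have := sqr_ge0 (a - b').
  have := sqr_ge0 (b - a'); have := sqr_ge0 (b - b'); have := sqr_ge0 (a' - b').
  rewrite !expr2; lra.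
apply: (@le_trans _ _ ((2 * m)^-1 * \sum_(i in G) \sum_(j in G)
    (2 * (m ^+ 2)^-1 * (al i + al j)))).
  apply: ler_wpM2l => //.
  by apply: ler_sum => i iG; apply: ler_sum => j jG; exact: h.
have -> : \sum_(i in G) \sum_(j in G) (2 * (m ^+ 2)^-1 * (al i + al j)) =
    4 * m^-1 * \sum_(i in G) al i.
  under eq_bigr do rewrite -mulr_sumr big_split /= sumr_const.
  rewrite -mulr_sumr big_split /= sumr_const sumrMnl.
  rewrite -[_ *+ #|G|]mulr_natl -/m.
  by field; rewrite gt_eqF.
apply: (@le_trans _ _ ((2 * m)^-1 * (4 * m^-1 *
   (4 * m ^+ 2 * d ^+ 2 * pavg G (fun s => (Y s - mu) ^+ 2))))).
  apply: ler_wpM2l => //; apply: ler_wpM2l => //.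
  by rewrite mulr_ge0 ?invr_ge0 ?ltW.
rewrite le_eqVlt; apply/orP; left; apply/eqP; field; rewrite ?gt_eqF//.
Qed.

(** The identity clamped to the [d]-neighbourhood of the interval from [x] to [y], centred to make
    its sup norm minimal. *)
Let clamp (x y u : R) := Num.max (x - d) (Num.min u (y + d)) - (x + y) / 2.

Let clamp_norm x y u : x <= y -> `|clamp x y u| <= (y - x) / 2 + d.
Proof.
have dp := d_gt0; move=> xy; rewrite ler_norml /clamp.
by case: (leP u (y + d)) => ?; case: (leP (x - d) _) => ?; lra.
Qed.

Let clamp_homo x y u u' : u <= u' -> clamp x y u <= clamp x y u'.
Proof.
move=> uu; rewrite /clamp lerD2r.
rewrite ge_max !le_max lexx /=; apply/orP; right.
by rewrite le_min !ge_min uu lexx orbT.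
Qed.

(** From a point of the interval, the clamped identity moves by at least the smaller of the distance
    and [d]; elsewhere monotonicity gives a nonnegative product. *)
Let clamp_mul x y u u' : x <= y ->
  (x <= u <= y)%R%:R * tsqr (u - u') <=
  (u - u') * (clamp x y u - clamp x y u').
Proof.
have dp := d_gt0; move=> xy.
have [/andP[xu uy]|_] := boolP (x <= u <= y); last first.
  rewrite mul0r; have [uu|/ltW uu] := leP u u'.
    by apply: mulr_le0; rewrite subr_le0 ?clamp_homo.
  by apply: mulr_ge0; rewrite subr_ge0 ?clamp_homo.
rewrite mul1r /clamp opprB addrA subrK.
rewrite (_ : Num.max (x - d) (Num.min u (y + d)) = u); last first.
  by case: (leP u (y + d)) => ?; case: (leP (x - d) _) => ?; lra.
rewrite /tsqr; have [uu|uu] := leP u u'.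
  rewrite ler0_norm ?subr_le0// opprB.
  rewrite -[X in _ <= X]mulrNN !opprB; apply: ler_wpM2l; first by rewrite subr_ge0.
  by case: (leP (u' - u) d) => ?; case: (leP u' (y + d)) => ?;
    case: (leP (x - d) _) => ?; lra.
rewrite ger0_norm ?subr_ge0 ?(ltW uu)//; apply: ler_wpM2l.
  by rewrite subr_ge0 ltW.
by case: (leP (u - u') d) => ?; case: (leP u' (y + d)) => ?;
  case: (leP (x - d) _) => ?; lra.
Qed.

(* Stein's identity for a clamped identity function bounds the expectation of
   [1_{x <= Y <= y} M]; the statistic [M] is then replaced by its mean, at the
   cost of its standard deviation. *)
Lemma permstat_concentration (x y v s0 : R) : x <= y -> 0 <= s0 ->
  pavg G (fun s => (permstat G B s - permstat_mean G B) ^+ 2) <= s0 ^+ 2 ->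
  v <= (4 * #|G|%:R ^+ 2 * (#|G|%:R - 1))^-1 *
    \sum_(i in G) \sum_(j in G) \sum_(k in G) \sum_(l in G)
      tsqr (crossdiff B i j k l) ->
  v * pavg G (fun s => (x <= permstat G B s <= y)%R%:R) <=
  s0 * ((y - x) / 2 + 4 * d).
Proof.
move=> xy s00 hs hv.
pose I s : R := (x <= Y s <= y)%R%:R.
rewrite -/Y -/(I _).
have I0 s : 0 <= I s by exact: ler0n.
have I1 s : I s <= 1 by rewrite /I; case: (_ <= _ <= _).
have mean_M : pavg G M = (4 * m ^+ 2 * (m - 1))^-1 *
    \sum_(i in G) \sum_(j in G) \sum_(k in G) \sum_(l in G)
      tsqr (crossdiff B i j k l).
  rewrite pavgZ pavg_sum; under eq_bigr do rewrite pavg_sum.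
  rewrite (sum_pavg_crossdiff G B tsqr tsqr0 G_gt1) -/m mulrA.
  congr (_ * _); rewrite -invfM; congr (_^-1); ring.
have l1 (h : {perm T} -> R) a : 0 <= a -> pavg G (fun s => h s ^+ 2) <= a ^+ 2 ->
    pavg G (fun s => `|h s|) <= a.
  move=> a0 ha; rewrite -(@ler_pXn2r _ 2)// ?nnegrE ?pavg_ge0//.
  apply: (le_trans (pavg_sqr_le _ _)); apply: le_trans ha.
  by apply: ler_pavg => s _; rewrite real_normK ?num_real.
have stein : pavg G (fun s => I s * M s) <= s0 * ((y - x) / 2 + d).
  apply: (@le_trans _ _ (pavg G (fun s => (Y s - mu) * clamp x y (Y s)))).
    rewrite [X in _ <= X](pavg_stein G B (clamp x y) (ltnW G_gt1)) -/m.
    rewrite (eq_pavg _ _ (fun s => (4 * m)^-1 * \sum_(i in G) \sum_(j in G)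
      (I s * w s i j))); last first.
      move=> s _; rewrite /M mulrCA mulr_sumr; congr (_ * _).
      by apply: eq_bigr => i _; rewrite mulr_sumr.
    rewrite pavgZ; apply: ler_wpM2l => //; rewrite pavg_sum.
    apply: ler_sum => i iG; rewrite pavg_sum; apply: ler_sum => j jG.
    apply: ler_pavg => s _.
    by rewrite /w -(permstat_swap G B)//; exact: clamp_mul.
  apply: (@le_trans _ _ (pavg G (fun s => ((y - x) / 2 + d) * `|Y s - mu|))).
    apply: ler_pavg => s _; apply: (le_trans (ler_norm _)).
    by rewrite normrM mulrC ler_wpM2r// clamp_norm.
  have c0 : 0 <= (y - x) / 2 + d by have := d_gt0; lra.
  by rewrite pavgZ mulrC ler_wpM2r// l1.
(* The standard deviation of [M] is at most [d * s0] times the square root of 8, rounded up to 3. *)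
have fluct : pavg G (fun s => I s * (pavg G M - M s)) <= 3 * d * s0.
  apply: (@le_trans _ _ (pavg G (fun s => `|M s - pavg G M|))).
    apply: ler_pavg => s _; apply: (le_trans (ler_norm _)).
    by rewrite normrM distrC ger0_norm// ler_piMl.
  apply: l1; first by rewrite !mulr_ge0// ltW.
  rewrite -pvarE; apply: (le_trans var_M).
  apply: (@le_trans _ _ (8 * d ^+ 2 * s0 ^+ 2)).
    by rewrite ler_wpM2l// mulr_ge0// sqr_ge0.
  have : 0 <= (d * s0) ^+ 2 by exact: sqr_ge0.
  rewrite !exprMn; lra.
apply: (@le_trans _ _ (pavg G M * pavg G I)).
  by rewrite ler_wpM2r ?pavg_ge0// mean_M.
have : pavg G M * pavg G I = pavg G (fun s => I s * M s) +
    pavg G (fun s => I s * (pavg G M - M s)).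
  rewrite -pavgD -pavgZ; apply: eq_pavg => s _; ring.
move=> ->; have -> : s0 * ((y - x) / 2 + 4 * d) =
  s0 * ((y - x) / 2 + d) + 3 * d * s0 by ring.
exact: lerD.
Qed.

End concentration.

(** * Oscillation of monotone functions under concentration *)

Section monotone_oscillation.
Context {R : realType} {T : finType}.
Variables (G : {set T}).

(** The sum is the integer part of [a]. *)
Let sum_steps (N : nat) (a : R) : 0 <= a <= N%:R ->
  a - 1 <= \sum_(k < N) ((k.+1%:R <= a)%R%:R : R) <= a.
Proof.
elim: N a => [|N IH] a.
  by rewrite big_ord0 => /andP[a0 a1]; lra.
move=> /andP[a0 aN]; rewrite big_ord_recr /=.
have [aN'|aN'] := leP a N%:R.
  rewrite [(N.+1%:R <= a)]leNgt (le_lt_trans aN') ?ltr_nat// addr0.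
  by apply: IH; rewrite a0.
rewrite (eq_bigr (fun=> 1)); last first.
  move=> k _; rewrite (_ : k.+1%:R <= a)//.
  by rewrite (le_trans _ (ltW aN'))// ler_nat.
rewrite sumr_const card_ord; move: aN; rewrite -(natr1 N) => aN.
have [h|h] := leP (N%:R + 1) a.
  by rewrite mulr1n; lra.
by rewrite mulr0n; lra.
Qed.

(* A nondecreasing function with range of length at most 1 is, up to [1 / N], the
   average of [N] indicators of up-rays; each ray separates [Y - e] from [Y + e]
   only when [Y] lies in some fixed interval of length [2 * e]. *)
Lemma pavg_homo_osc (Y : {perm T} -> R) (g : R -> R) (lo e c : R) :
  {homo g : x y / x <= y} -> (forall u, lo <= g u <= lo + 1) ->
  (forall x, pavg G (fun s => (x <= Y s <= x + 2 * e)%R%:R) <= c) ->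
  pavg G (fun s => g (Y s + e) - g (Y s - e)) <= c.
Proof.
move=> gmono gb hc.
have ray lam : pavg G (fun s => (g (Y s - e) < lam <= g (Y s + e))%R%:R) <= c.
  pose P s := perm_on G s && (g (Y s - e) < lam <= g (Y s + e)).
  have [s1 P1|P0] := pickP P; last first.
    apply: le_trans (hc 0); apply: ler_pavg => s Gs.
    by have := P0 s; rewrite /P Gs /= => ->.
  (* The interval starts at the least separated value of [Y]: beyond [Y s0 + 2 * e], already
     [g (Y s - e)] is at least [g (Y s0 + e)], hence at least [lam]. *)
  case: (arg_minP Y P1) => s0 /andP[_ /andP[_ h0]] hmin.
  apply: le_trans (hc (Y s0)); apply: ler_pavg => s Gs.
  have [As|//] := boolP (g (Y s - e) < lam <= g (Y s + e)).
  rewrite (hmin s) /=; last by rewrite /P Gs.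
  suff -> : Y s <= Y s0 + 2 * e by [].
  rewrite leNgt; apply/negP => lt; case/andP: As => As _.
  have : g (Y s0 + e) <= g (Y s - e) by apply: gmono; lra.
  by rewrite leNgt (lt_le_trans As h0).
set X := pavg G _; rewrite leNgt; apply/negP => cX.
pose N := Num.bound (X - c)^-1.
have hN : 1 < N%:R * (X - c).
  rewrite -ltr_pdivrMr ?subr_gt0// div1r.
  by have := archi_boundP (_ : 0 <= (X - c)^-1); apply; rewrite invr_ge0 subr_ge0 ltW.
pose st u : R := \sum_(k < N) ((k.+1%:R <= N%:R * (g u - lo))%R%:R : R).
have stP u : N%:R * (g u - lo) - 1 <= st u <= N%:R * (g u - lo).
  apply: sum_steps; have := gb u => /andP[g1 g2].
  rewrite mulr_ge0 ?subr_ge0//= ler_piMr//; lra.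
have N0 : 0 < N%:R :> R.
  rewrite ltr0n lt0n; apply/eqP => N0; move: hN; rewrite N0 mul0r; lra.
have : N%:R * X <= \sum_(k < N) c + 1.
  rewrite /X -pavgZ; apply: (@le_trans _ _ (pavg G (fun s =>
     \sum_(k < N) ((g (Y s - e) < lo + k.+1%:R / N%:R <= g (Y s + e))%R%:R : R) + 1))).
    apply: ler_pavg => s _.
    have [p1 p2] := andP (stP (Y s + e)); have [p3 p4] := andP (stP (Y s - e)).
    apply: (@le_trans _ _ (st (Y s + e) - st (Y s - e) + 1)); first by lra.
    rewrite lerD2r /st -sumrB; apply: ler_sum => k _.
    have E u : (k.+1%:R <= N%:R * (g u - lo)) = (lo + k.+1%:R / N%:R <= g u).
      by rewrite -lerBrDl ler_pdivrMr// mulrC.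
    rewrite !E; rewrite [g (Y s - e) < _]ltNge.
    by case: (_ <= g (Y s - e)); case: (_ <= g (Y s + e)); rewrite ?subrr ?subr0 ?sub0r//=; lra.
  rewrite pavgD pavg_cst lerD2r pavg_sum; apply: ler_sum => k _; exact: ray.
rewrite sumr_const card_ord -[c *+ _]mulr_natl; lra.
Qed.

End monotone_oscillation.

(** * Sums over quadruples of indices *)

Section quadruple_sums.
Context {R : realFieldType} {T : finType}.
Implicit Types (G F : {set T}) (f g : T -> T -> T -> T -> R).

Definition sum4 G f : R :=
  \sum_(i in G) \sum_(j in G) \sum_(k in G) \sum_(l in G) f i j k l.

Lemma sum_setT (f : T -> R) : \sum_(i in [set: T]) f i = \sum_i f i.
Proof. by apply: eq_bigl => i; rewrite in_setT. Qed.

Lemma sum4_setT f :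
  sum4 [set: T] f = \sum_i \sum_j \sum_k \sum_l f i j k l.
Proof.
rewrite /sum4 sum_setT; apply: eq_bigr => i _; rewrite sum_setT.
by apply: eq_bigr => j _; rewrite sum_setT; apply: eq_bigr => k _; rewrite sum_setT.
Qed.

Lemma ler_sum4 G f g : (forall i j k l, f i j k l <= g i j k l) ->
  sum4 G f <= sum4 G g.
Proof. by move=> fg; do 4! apply: ler_sum => ? _. Qed.

Lemma sum4_ge0 G f : (forall i j k l, 0 <= f i j k l) -> 0 <= sum4 G f.
Proof. by move=> f0; do 4! apply: sumr_ge0 => ? _. Qed.

Lemma sum4D G f g :
  sum4 G (fun i j k l => f i j k l + g i j k l) = sum4 G f + sum4 G g.
Proof.
rewrite /sum4 -big_split; apply: eq_bigr => i _; rewrite -big_split.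
by apply: eq_bigr => j _; rewrite -big_split; apply: eq_bigr => k _; rewrite -big_split.
Qed.

Lemma sum4Z G (c : R) f : sum4 G (fun i j k l => c * f i j k l) = c * sum4 G f.
Proof.
rewrite /sum4 mulr_sumr; apply: eq_bigr => i _; rewrite mulr_sumr.
by apply: eq_bigr => j _; rewrite mulr_sumr; apply: eq_bigr => k _; rewrite mulr_sumr.
Qed.

Lemma sum4_cst G (c : R) : sum4 G (fun _ _ _ _ => c) = #|G|%:R ^+ 4 * c.
Proof.
have E (x : R) : \sum_(i in G) x = #|G|%:R * x.
  by rewrite sumr_const -[LHS]mulr_natl.
by rewrite /sum4 !E; ring.
Qed.

Lemma sum4_perm (s : {perm T}) f :
  sum4 [set: T] (fun i j k l => f i j (s k) (s l)) = sum4 [set: T] f.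
Proof.
have sT := perm_onT s.
apply: eq_bigr => i _; apply: eq_bigr => j _.
rewrite -(reindex_perm_on _ _ (fun k => \sum_(l in [set: T]) f i j k l) sT).
by apply: eq_bigr => k _; rewrite (reindex_perm_on _ _ (f i j (s k)) sT).
Qed.

Let ind F i : R := (i \in F)%:R.

Let sum_in G (f : T -> R) : \sum_(i in G) f i = \sum_i ind G i * f i.
Proof.
rewrite big_mkcond; apply: eq_bigr => i _; rewrite /ind.
by case: (i \in G); rewrite ?mul1r ?mul0r.
Qed.

Let sum4_ind G f : sum4 G f = sum4 [set: T] (fun i j k l =>
  ind G i * (ind G j * (ind G k * (ind G l * f i j k l)))).
Proof.
rewrite /sum4 sum_in sum_setT; apply: eq_bigr => i _.
rewrite sum_in sum_setT mulr_sumr; apply: eq_bigr => j _.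
rewrite sum_in sum_setT !mulr_sumr; apply: eq_bigr => k _.
by rewrite sum_in sum_setT !mulr_sumr.
Qed.

Lemma sum4_sub G f : (forall i j k l, 0 <= f i j k l) ->
  sum4 G f <= sum4 [set: T] f.
Proof.
move=> f0; rewrite (sum4_ind G); apply: ler_sum4 => i j k l; rewrite /ind.
by do 4! case: (_ \in G); rewrite ?mul1r ?mul0r.
Qed.

(* The factors [(1 + g) / 2] bound [sqrt g] on the quadruples meeting [F]. *)
Lemma sum4_setC F f g (d : R) : 0 <= d ->
  (forall i j k l, 0 <= f i j k l) -> (forall i j k l, 0 <= g i j k l) ->
  (forall i j k l, f i j k l <= d * ((1 + g i j k l) / 2)) ->
  sum4 [set: T] f <= sum4 (~: F) f +
    d * (2 * #|F|%:R * #|T|%:R ^+ 3 + 2 * sum4 [set: T] g).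
Proof.
move=> d0 f0 g0 fg; rewrite (sum4_ind (~: F)).
have C (c : R) : \sum_(i in [set: T]) c = #|T|%:R * c.
  by rewrite sumr_const cardsT -[LHS]mulr_natl.
have I : \sum_(i in [set: T]) ind F i = #|F|%:R.
  by rewrite sum_setT -[RHS]mulr1 mulr_natl -sumr_const sum_in; apply: eq_bigr => i _;
    rewrite mulr1.
have -> : d * (2 * #|F|%:R * #|T|%:R ^+ 3 + 2 * sum4 [set: T] g) =
  sum4 [set: T] (fun i j k l => (d / 2) * (ind F i + ind F j + ind F k + ind F l
    + 4 * g i j k l)).
  rewrite sum4Z !sum4D sum4Z.
  have -> : sum4 [set: T] (fun i j k l => ind F i) = #|F|%:R * #|T|%:R ^+ 3.
    rewrite /sum4; under eq_bigr do rewrite !C.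
    by rewrite -!mulr_sumr I; ring.
  have -> : sum4 [set: T] (fun i j k l => ind F j) = #|F|%:R * #|T|%:R ^+ 3.
    rewrite /sum4 C; under eq_bigr do rewrite !C.
    by rewrite -!mulr_sumr I; ring.
  have -> : sum4 [set: T] (fun i j k l => ind F k) = #|F|%:R * #|T|%:R ^+ 3.
    rewrite /sum4 !C; under eq_bigr do rewrite !C.
    by rewrite -!mulr_sumr I; ring.
  have -> : sum4 [set: T] (fun i j k l => ind F l) = #|F|%:R * #|T|%:R ^+ 3.
    by rewrite /sum4 !C I; ring.
  by field.
rewrite -sum4D; apply: ler_sum4 => i j k l; rewrite /ind !inE.
move: (f0 i j k l) (g0 i j k l) (fg i j k l).
set u := f i j k l; set v := g i j k l => u0 v0 uv.
have dv : 0 <= d * v by rewrite mulr_ge0.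
do 4! case: (_ \in F) => /=;
  rewrite ?(mulr0n, mulr1n, mul0r, mul1r, mulr0); lra.
Qed.

End quadruple_sums.

(** * Pointwise inequalities for truncated powers *)

Section truncated_square.
Context {R : realFieldType}.

Definition trunc3 (u : R) : R := u ^+ 2 * Num.min 1 `|65 / 100 * u|.

Lemma trunc3_ge0 u : 0 <= trunc3 u.
Proof. by rewrite mulr_ge0 ?sqr_ge0// le_min ler01 normr_ge0. Qed.

Lemma trunc3_0 : trunc3 0 = 0. Proof. by rewrite /trunc3 expr0n mul0r. Qed.

Lemma trunc3_ge (u t : R) : 0 <= t <= 1 ->
  65 / 100 * t * (u ^+ 2 - t ^+ 2) <= trunc3 u.
Proof.
move=> /andP[t0 t1]; have u2 := sqr_ge0 u.
have [ut|tu] := leP `|u| t.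
  apply: le_trans (trunc3_ge0 u); apply: mulr_ge0_le0; first by lra.
  rewrite subr_le0 -(real_normK (num_real u)).
  by apply: lerXn2r; rewrite ?nnegrE.
apply: (@le_trans _ _ (u ^+ 2 * (65 / 100 * t))).
  have : 0 <= 65 / 100 * t * t ^+ 2 by rewrite !mulr_ge0//; lra.
  lra.
apply: ler_wpM2l => //; rewrite le_min normrM (ger0_norm (_ : 0 <= 65/100)); lra.
Qed.

(** Where the minimum in [trunc3] is [65 / 100 * x], with [x] the absolute value of [u], the left
    side divided by [x] is [x - 13 / 40 * x ^ 2 / b]. Its maximum [10 / 13 * b] is the threshold.
    Where the minimum is 1, the left side is nonpositive because [2 * b <= 1]. *)
Lemma tsqr_ge (b u : R) : 0 < b <= 1 / 2 ->
  u ^+ 2 - (2 * b)^-1 * trunc3 u <= tsqr (10 / 13 * b) u.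
Proof.
move=> /andP[b0 b1]; rewrite /trunc3 /tsqr normrM (ger0_norm (_ : 0 <= 65/100)); last lra.
rewrite -(real_normK (num_real u)); set x := `|u|.
have x0 : 0 <= x by exact: normr_ge0.
have i0 : 0 <= (2 * b)^-1 by rewrite invr_ge0; lra.
have [xd|dx] := leP x (10 / 13 * b).
  have : 0 <= (2 * b)^-1 * (x ^+ 2 * Num.min 1 (65 / 100 * x)).
    by rewrite !mulr_ge0// le_min; lra.
  rewrite -expr2; lra.
have [h1|h1] := leP 1 (65 / 100 * x).
  have i1 : 1 <= (2 * b)^-1 by rewrite -[1]invr1 lef_pV2 ?posrE; lra.
  have : 0 <= (x ^+ 2) * ((2 * b)^-1 - 1) by rewrite mulr_ge0 ?sqr_ge0//; lra.
  have : 0 <= x * (10 / 13 * b) by rewrite mulr_ge0//; lra.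
  lra.
have : 0 <= x * ((13 / 10 * x - 2 * b) ^+ 2 / (52 / 10 * b)).
  by rewrite mulr_ge0// divr_ge0 ?sqr_ge0//; lra.
have -> : x * ((13 / 10 * x - 2 * b) ^+ 2 / (52 / 10 * b)) =
  x * (10 / 13 * b) - (x ^+ 2 - (2 * b)^-1 * (x ^+ 2 * (65 / 100 * x))).
  by field; rewrite gt_eqF.
lra.
Qed.

End truncated_square.

(** * Concentration given the images of a few points *)

Section conditional_concentration.
Context {R : realFieldType} {T : finType}.
Variable a : T -> T -> R.
Local Notation n := (#|T|%:R : R).
Local Notation cd := (crossdiff a).

Hypothesis T_gt1 : (1 < #|T|)%N.
Hypothesis var1 :
  sum4 [set: T] (fun i j k l => cd i j k l ^+ 2) = 4 * n ^+ 2 * (n - 1).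

(* With the normalization [var1], this is a quarter of [gamma a (65 / 100)]. *)
Definition beta : R := (4 * n ^+ 2 * (n - 1))^-1 *
  sum4 [set: T] (fun i j k l => trunc3 (cd i j k l)).

Let n_ge2 : 2 <= n. Proof. by rewrite ler_nat. Qed.

Let norm_gt0 : 0 < 4 * n ^+ 2 * (n - 1).
Proof. by rewrite !mulr_gt0 ?exprn_gt0//; have := n_ge2; lra. Qed.

Let sum4_trunc3 :
  sum4 [set: T] (fun i j k l => trunc3 (cd i j k l)) =
  4 * n ^+ 2 * (n - 1) * beta.
Proof. by rewrite /beta mulVKf// gt_eqF. Qed.

Let beta_ge (t : R) : 0 <= t <= 1 ->
  65 / 100 * t * (4 * (n - 1) - n ^+ 2 * t ^+ 2) <= 4 * (n - 1) * beta.
Proof.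
move=> t01.
have n2 : 0 < n ^+ 2 by rewrite exprn_gt0//; have := n_ge2; lra.
rewrite -(ler_pM2l n2).
have -> : n ^+ 2 * (4 * (n - 1) * beta) = 4 * n ^+ 2 * (n - 1) * beta by ring.
rewrite -sum4_trunc3.
have -> : n ^+ 2 * (65 / 100 * t * (4 * (n - 1) - n ^+ 2 * t ^+ 2)) =
   sum4 [set: T] (fun i j k l => 65 / 100 * t * (cd i j k l ^+ 2 + - t ^+ 2)).
  by rewrite sum4Z sum4D sum4_cst var1 cardsT; ring.
by apply: ler_sum4 => i j k l; exact: trunc3_ge.
Qed.

Lemma beta_gt0 : 0 < beta.
Proof.
have n2 := n_ge2.
(* At [t = 1 / n] the subtracted term [n ^ 2 * t ^ 2] is 1. *)
have := beta_ge n^-1 ltac:(rewrite invr_ge0 ler0n invf_le1; lra).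
have -> : 65 / 100 * n^-1 * (4 * (n - 1) - n ^+ 2 * n^-1 ^+ 2) =
   65 / 100 * n^-1 * (4 * n - 5) by field; lra.
have : 0 < 65 / 100 * n^-1 * (4 * n - 5) by rewrite !mulr_gt0 ?invr_gt0; lra.
move=> h1 h2; have : 0 < 4 * (n - 1) * beta by exact: lt_le_trans h2.
by rewrite pmulr_rgt0//; lra.
Qed.

Lemma card_ge100 : beta <= 1 / 63 -> 100 <= n.
Proof.
move=> b63; rewrite leNgt; apply/negP => n100.
have n2 := n_ge2.
have n99 : n <= 99 by move: n100; rewrite ltr_nat ltnS -(ler_nat R).
have := beta_ge (14 / 100) ltac:(lra).
(* The inequality to refute has a difference of sides concave in [n], so it is enough that it fails
   at 2 and at 99; this product expresses the concavity. *)
have h : 0 <= (99 - n) * (n - 2) by rewrite mulr_ge0; lra.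
have h2 : (n - 1) * beta <= (n - 1) * (1 / 63) by rewrite ler_wpM2l; lra.
move: h h2; rewrite !expr2; lra.
Qed.

Hypothesis beta_le : beta <= 1 / 63.
Local Notation d := (10 / 13 * beta).

(** Freezing the images of [F] leaves a permutation statistic on the complement. As [n >= 100] and
    [F] has at most four points, its variance and mean truncated square are close to those of the
    full statistic, and [permstat_concentration] applies. *)
Lemma conditional_concentration (F : {set T}) (p : {perm T}) (x y : R) :
  (#|F| <= 4)%N -> x <= y ->
  pavg (~: F) (fun s =>
    (x <= permstat (~: F) (fun i k => a i (p k)) s <= y)%R%:R) <=
  5 / 2 * ((y - x) / 2 + 4 * d).
Proof.
move=> F4 xy; set G := ~: F; pose B i k := a i (p k).
have b0 := beta_gt0; have n100 := card_ge100 beta_le.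
have bl := beta_le.
have b2 : 0 < beta <= 1 / 2 by lra.
pose m : R := #|G|%:R.
have Fn : #|F|%:R <= 4 :> R by rewrite ler_nat.
have mE : m = n - #|F|%:R.
  by rewrite /m -(cardsC F) natrD addrC addKr.
have F0 : 0 <= #|F|%:R :> R by exact: ler0n.
have G1 : (1 < #|G|)%N by rewrite -(ltr_nat R) -/m; lra.
have dB : 0 < d by lra.
have sumB : sum4 [set: T] (fun i j k l => crossdiff B i j k l ^+ 2) =
    4 * n ^+ 2 * (n - 1).
  by rewrite -var1 -[RHS](sum4_perm p).
have var : pavg G (fun s => (permstat G B s - permstat_mean G B) ^+ 2) <=
    (11 / 10) ^+ 2.
  have z0 : (0 : R) ^+ 2 = 0 by rewrite expr0n.
  rewrite (permstat_var G B (ltnW G1)).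
  rewrite (sum_pavg_crossdiff G B (fun u => u ^+ 2) z0 G1).
  rewrite -/m -/(sum4 G (fun i j k l => crossdiff B i j k l ^+ 2)) mulrA -invfM.
  rewrite mulrC ler_pdivrMr; last by rewrite !mulr_gt0//; lra.
  apply: (le_trans (sum4_sub _ _ _)); first by move=> *; exact: sqr_ge0.
  rewrite sumB.
  have h1 : (n - 4) ^+ 2 <= m ^+ 2.
    by apply: lerXn2r; rewrite ?nnegrE; lra.
  have h2 : (n - 4) ^+ 2 * (n - 5) <= m ^+ 2 * (m - 1).
    by apply: ler_pM; rewrite ?sqr_ge0//; lra.
  have h3 : n ^+ 2 * (n - 1) <= 121 / 100 * ((n - 4) ^+ 2 * (n - 5)).
    have t0 : 0 <= n - 100 by lra.
    have t2 : 0 <= (n - 100) ^+ 2 by exact: sqr_ge0.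
    have t3 : 0 <= (n - 100) ^+ 3 by exact: exprn_ge0.
    move: t0 t2 t3; rewrite !exprS expr0; lra.
  rewrite !expr2 in h2 h3 *; lra.
(* By [tsqr_ge] the sum over all quadruples is at least half of [4 * n ^ 2 * (n - 1)]; those meeting
   [F] cost at most a twentieth of it. *)
have mean : 445 / 1000 <= (4 * #|G|%:R ^+ 2 * (#|G|%:R - 1))^-1 *
    sum4 G (fun i j k l => tsqr d (crossdiff B i j k l)).
  have full : 2 * n ^+ 2 * (n - 1) <=
      sum4 [set: T] (fun i j k l => tsqr d (crossdiff B i j k l)).
    have -> : 2 * n ^+ 2 * (n - 1) = sum4 [set: T] (fun i j k l =>
        crossdiff B i j k l ^+ 2 + - (2 * beta)^-1 * trunc3 (crossdiff B i j k l)).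
      rewrite sum4D sum4Z sumB.
      have -> : sum4 [set: T] (fun i j k l => trunc3 (crossdiff B i j k l)) =
          4 * n ^+ 2 * (n - 1) * beta.
        by rewrite -sum4_trunc3 -[RHS](sum4_perm p).
      by field; lra.
    apply: ler_sum4 => i j k l; rewrite mulNr; exact: tsqr_ge.
  have tq i j k l : tsqr d (crossdiff B i j k l) <=
      d * ((1 + crossdiff B i j k l ^+ 2) / 2).
    apply: (le_trans (tsqr_le _ _)); apply: ler_wpM2l; first exact: ltW.
    set u := crossdiff B i j k l; rewrite -(real_normK (num_real u)).
    by have := sqr_ge0 (`|u| - 1); rewrite !expr2; lra.
  have loss := sum4_setC F (fun i j k l => tsqr d (crossdiff B i j k l))
    (fun i j k l => crossdiff B i j k l ^+ 2) d (ltW dB)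
    (fun i j k l => tsqr_ge0 d dB _) (fun i j k l => sqr_ge0 _) tq.
  move: loss; rewrite -/G sumB; set S := sum4 G _ => loss.
  rewrite [X in _ <= X]mulrC ler_pdivlMr; last by rewrite -/m !mulr_gt0 ?exprn_gt0//; lra.
  rewrite -/m.
  have n3 : 0 <= n ^+ 3 by exact: exprn_ge0.
  have h1 : m ^+ 2 * (m - 1) <= n ^+ 2 * (n - 1).
    apply: ler_pM; rewrite ?sqr_ge0//; [lra| |lra].
    by apply: lerXn2r; rewrite ?nnegrE; lra.
  have h2 : 2 * #|F|%:R * n ^+ 3 + 2 * (4 * n ^+ 2 * (n - 1)) <= 16 * n ^+ 3.
    have : #|F|%:R * n ^+ 3 <= 4 * n ^+ 3 by rewrite ler_wpM2r.
    have : 0 <= n ^+ 2 by exact: sqr_ge0.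
    rewrite !exprS expr0; lra.
  have h3 : d * (2 * #|F|%:R * n ^+ 3 + 2 * (4 * n ^+ 2 * (n - 1))) <=
      10 / 13 * (1 / 63) * (16 * n ^+ 3).
    apply: ler_pM => //; [exact: ltW| |lra].
    have n10 : 0 <= n - 1 by lra.
    have p1 : 0 <= n ^+ 2 * (n - 1) by rewrite mulr_ge0 ?sqr_ge0.
    have p2 : 0 <= #|F|%:R * n ^+ 3 by rewrite mulr_ge0.
    lra.
  have h4 : 0 <= n ^+ 2 * (n - 100) by rewrite mulr_ge0 ?sqr_ge0//; lra.
  rewrite !exprS expr0 in loss full n3 h1 h2 h3 h4 *; lra.
have conc := permstat_concentration G B d dB G1 x y (445 / 1000) (11 / 10) xy
  ltac:(lra) var mean.
(* The quotient of [11 / 10] by [445 / 1000] is below [5 / 2]. *)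
move: conc; set P := pavg G _; have : 0 <= (y - x) / 2 by lra.
lra.
Qed.

End conditional_concentration.

(** * Normal approximation *)

Lemma min1D (R : realFieldType) (x y : R) : 0 <= x -> 0 <= y ->
  Num.min 1 (x + y) <= Num.min 1 x + Num.min 1 y.
Proof.
by move=> x0 y0; case: (leP 1 (x + y)) => ?; case: (leP 1 x) => ?;
  case: (leP 1 y) => ?; lra.
Qed.

Section combinatorial_clt.
Context {R : realType} {T : finType}.
Variable a : T -> T -> R.
Local Notation n := (#|T|%:R : R).
Local Notation cd := (crossdiff a).
Local Notation W := (permstat [set: T] a).

Hypothesis T_gt1 : (1 < #|T|)%N.
Hypothesis mean0 : permstat_mean [set: T] a = 0.
Hypothesis var1 :
  sum4 [set: T] (fun i j k l => cd i j k l ^+ 2) = 4 * n ^+ 2 * (n - 1).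

Let n_ge2 : 2 <= n. Proof. by rewrite ler_nat. Qed.

Let norm_gt0 : 0 < 4 * n ^+ 2 * (n - 1).
Proof. by rewrite !mulr_gt0 ?exprn_gt0//; have := n_ge2; lra. Qed.

(** The inner average is the conditional expectation given the values of [p] outside [G], since
    [s * p] agrees with [p] there. *)
Let pavg_cond (G : {set T}) (h : {perm T} -> R) :
  pavg [set: T] h = pavg [set: T] (fun p => pavg G (fun s => h (s * p)%g)).
Proof.
transitivity (pavg G (fun s => pavg [set: T] (fun p => h (s * p)%g))).
  rewrite -[LHS](pavg_cst G); apply: eq_pavg => s _.
  by rewrite (pavg_mull _ s h (perm_onT s)).
by rewrite /pavg -!mulr_sumr mulrCA exchange_big.
Qed.

Let W_swap p i j : W p - W (tperm i j * p)%g = cd i j (p i) (p j).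
Proof. by rewrite permstat_swap ?in_setT. Qed.

Let sumQ (f : T -> T -> T -> T -> R) : R :=
  \sum_i \sum_(j | j != i) \sum_k \sum_(l | l != i) f i j k l.

Let sumQZ c f : sumQ (fun i j k l => c * f i j k l) = c * sumQ f.
Proof.
rewrite /sumQ mulr_sumr; apply: eq_bigr => i _; rewrite mulr_sumr.
by apply: eq_bigr => j _; rewrite mulr_sumr; apply: eq_bigr => k _; rewrite mulr_sumr.
Qed.

Let sumQD f g :
  sumQ (fun i j k l => f i j k l + g i j k l) = sumQ f + sumQ g.
Proof.
rewrite /sumQ -big_split; apply: eq_bigr => i _; rewrite -big_split.
by apply: eq_bigr => j _; rewrite -big_split; apply: eq_bigr => k _; rewrite -big_split.
Qed.

Let eq_sumQ f g : (forall i j k l, j != i -> l != i -> f i j k l = g i j k l) ->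
  sumQ f = sumQ g.
Proof.
by move=> fg; apply: eq_bigr => i _; apply: eq_bigr => j ji; apply: eq_bigr => k _;
  apply: eq_bigr => l li; exact: fg.
Qed.

Let sumQ_pavg f : sumQ (fun i j k l => pavg [set: T] (f i j k l)) =
  pavg [set: T] (fun p => sumQ (fun i j k l => f i j k l p)).
Proof.
rewrite /sumQ pavg_sum; apply: eq_bigr => i _; rewrite pavg_sum.
apply: eq_bigr => j _; rewrite pavg_sum; apply: eq_bigr => k _.
by rewrite pavg_sum.
Qed.

Let sum_neq_cst (i : T) (x : R) : \sum_(l | l != i) x = (n - 1) * x.
Proof.
have -> : n - 1 = #|predC1 i|%:R by rewrite cardC1 -subn1 natrB// ltnW.
by rewrite mulr_natl -sumr_const; apply: eq_bigl.
Qed.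

Let sum_cst (x : R) : \sum_(l : T) x = n * x.
Proof. by rewrite sumr_const [RHS]mulr_natl. Qed.

Let p1 (i k : T) (p : {perm T}) : {perm T} := (tperm i k * p)%g.
Let p2 (i j k l : T) (p : {perm T}) : {perm T} := (tperm j l * p1 i k p)%g.
Let D i j k l p := W (p2 i j k l p) - W (tperm i j * p2 i j k l p)%g.
Let U1 i k p := W p - W (p1 i k p).
Let U2 i j k l p := W (p1 i k p) - W (p2 i j k l p).

(* For [l] distinct from [i], the permutation [p2 i j k l p] maps [i] to [p k] and
   [j] to [p1 i k p l]; when [k] and [l] vary, these images run over all ordered pairs
   of distinct points, whatever [p]. This is what decouples [D] from [W p]. *)
Let D_E i j k l p : j != i -> l != i -> D i j k l p = cd i j (p k) (p1 i k p l).
Proof.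
move=> ji li; rewrite /D W_swap /p2 permM tpermD// permM tpermL.
by rewrite {1}/p1 permM tpermL.
Qed.

(** For each [p], reindexing [k] by [p] and [l] by [p1 i k p] gives all pairs of images; the missing
    [l = i] is the diagonal, where the cross difference is 0. *)
Let sumQ_D (f : R -> R) p : f 0 = 0 ->
  sumQ (fun i j k l => f (D i j k l p)) =
  sum4 [set: T] (fun i j k l => f (cd i j k l)).
Proof.
move=> f0.
rewrite (eq_sumQ _ (fun i j k l => f (cd i j (p k) (p1 i k p l)))); last first.
  by move=> i j k l ji li; rewrite D_E.
rewrite sum4_setT; apply: eq_bigr => i _.
rewrite [RHS](bigD1 i)//= [X in _ = X + _]big1 ?add0r; last first.
  move=> k _; rewrite big1// => l _; rewrite -[RHS]f0; congr f.
  by rewrite /crossdiff; ring.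
apply: eq_bigr => j ji; rewrite [RHS](reindex_inj (@perm_inj _ p)).
apply: eq_bigr => k _; rewrite [RHS](reindex_inj (@perm_inj _ (p1 i k p))).
rewrite [RHS](bigD1 i)//= {2}/p1 permM tpermL.
have -> : cd i j (p k) (p k) = 0 by rewrite /crossdiff; ring.
by rewrite f0 add0r.
Qed.

Let sum_pair_pavg (f : R -> R) : f 0 = 0 ->
  \sum_i \sum_j pavg [set: T] (fun p => f (cd i j (p i) (p j))) =
  (n * (n - 1))^-1 * sum4 [set: T] (fun i j k l => f (cd i j k l)).
Proof.
move=> f0; have := sum_pavg_crossdiff [set: T] a f f0.
rewrite cardsT => /(_ T_gt1) <-; rewrite sum_setT; apply: eq_bigr => i _.
by rewrite sum_setT.
Qed.

Let sumQ_U1 (f : R -> R) : f 0 = 0 -> (forall u, 0 <= f u) ->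
  sumQ (fun i j k l => pavg [set: T] (fun p => f (U1 i k p))) <=
  sum4 [set: T] (fun i j k l => f (cd i j k l)).
Proof.
move=> f0 fp; have n2 := n_ge2.
have -> : sumQ (fun i j k l => pavg [set: T] (fun p => f (U1 i k p))) =
  (n - 1) ^+ 2 * \sum_i \sum_k pavg [set: T] (fun p => f (cd i k (p i) (p k))).
  rewrite /sumQ mulr_sumr; apply: eq_bigr => i _.
  rewrite sum_neq_cst; under eq_bigr do rewrite sum_neq_cst.
  rewrite -mulr_sumr mulrA -expr2; congr (_ * _); apply: eq_bigr => k _.
  by apply: eq_pavg => p _; rewrite /U1 W_swap.
rewrite sum_pair_pavg// mulrA -[X in _ <= X]mul1r ler_wpM2r ?sum4_ge0//.
have -> : (n - 1) ^+ 2 / (n * (n - 1)) = (n - 1) / n by field; lra.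
rewrite ler_pdivrMr; lra.
Qed.

(** Each average depends only on [j] and [l], and dropping the constraints [j != i] and [l != i]
    only adds nonnegative terms. *)
Let sumQ_U2 (f : R -> R) : f 0 = 0 -> (forall u, 0 <= f u) ->
  sumQ (fun i j k l => pavg [set: T] (fun p => f (U2 i j k l p))) <=
  n / (n - 1) * sum4 [set: T] (fun i j k l => f (cd i j k l)).
Proof.
move=> f0 fp; have n2 := n_ge2.
pose g j l := pavg [set: T] (fun p => f (cd j l (p j) (p l))).
have g0 j l : 0 <= g j l by apply: pavg_ge0 => s _; exact: fp.
have E i j k l : pavg [set: T] (fun p => f (U2 i j k l p)) = g j l.
  rewrite /g -[RHS](pavg_mull _ (tperm i k) _ (perm_onT _)).
  by apply: eq_pavg => p _; rewrite /U2 W_swap.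
apply: (@le_trans _ _ (\sum_(i : T) \sum_(k : T) \sum_j \sum_l g j l)).
  apply: ler_sum => i _; rewrite exchange_big; apply: ler_sum => k _.
  rewrite [X in _ <= X](bigID (fun j => j != i)) /=.
  rewrite -[X in X <= _]addr0; apply: lerD; last first.
    by apply: sumr_ge0 => j _; apply: sumr_ge0 => l _.
  apply: ler_sum => j _; rewrite [X in _ <= X](bigID (fun l => l != i)) /=.
  rewrite -[X in X <= _]addr0; apply: lerD; last by apply: sumr_ge0 => l _.
  by apply: ler_sum => l _; rewrite E.
rewrite !sum_cst sum_pair_pavg// !mulrA le_eqVlt; apply/orP; left; apply/eqP.
by congr (_ * _); field; lra.
Qed.

(** [p2 i j k l p] is uniform when [p] is, so the summand depends only on [i] and [j], and the sum
    over [k] and [l] multiplies [pavg_stein] by [n * (n - 1)]. *)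
Let stein_W (f : R -> R) :
  pavg [set: T] (fun p => W p * f (W p)) =
  (4 * n ^+ 2 * (n - 1))^-1 * sumQ (fun i j k l => pavg [set: T] (fun p =>
    D i j k l p * (f (W (p2 i j k l p)) - f (W (tperm i j * p2 i j k l p)%g)))).
Proof.
have n2 := n_ge2.
pose e i j := pavg [set: T] (fun p => (W p - W (tperm i j * p)%g) *
   (f (W p) - f (W (tperm i j * p)%g))).
have E i j k l : pavg [set: T] (fun p =>
    D i j k l p * (f (W (p2 i j k l p)) - f (W (tperm i j * p2 i j k l p)%g)))
    = e i j.
  pose h p := (W p - W (tperm i j * p)%g) * (f (W p) - f (W (tperm i j * p)%g)).
  rewrite /e -/h -[RHS](pavg_mull _ (tperm j l) h (perm_onT _)).
  by rewrite -[RHS](pavg_mull _ (tperm i k) _ (perm_onT _)).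
have -> : sumQ (fun i j k l => pavg [set: T] (fun p =>
    D i j k l p * (f (W (p2 i j k l p)) - f (W (tperm i j * p2 i j k l p)%g))))
   = n * (n - 1) * \sum_i \sum_j e i j.
  rewrite /sumQ mulr_sumr; apply: eq_bigr => i _.
  rewrite mulr_sumr [RHS](bigD1 i)//=.
  have -> : e i i = 0.
    rewrite /e -[RHS](pavg_cst [set: T]); apply: eq_pavg => p _.
    by rewrite tperm1 mul1g subrr mul0r.
  rewrite mulr0 add0r; apply: eq_bigr => j _.
  under eq_bigr do under eq_bigr do rewrite E.
  by rewrite sum_cst sum_neq_cst mulrA.
have T0 : (0 < #|[set: T]|)%N by rewrite cardsT ltnW.
have := pavg_stein [set: T] a f T0; rewrite mean0 cardsT => h.
transitivity (pavg [set: T] (fun p => (W p - 0) * f (W p))).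
  by apply: eq_pavg => p _; rewrite subr0.
rewrite h sum_setT (eq_bigr (fun i => \sum_j e i j)); last by move=> i _; rewrite sum_setT.
by field; lra.
Qed.

Local Notation b := (beta a).
Local Notation d := (10 / 13 * b).

Hypothesis beta_le : b <= 1 / 63.

(* Given the images of [i], [j], [k], [l], the oscillation of the Stein solution
   over an interval of fixed radius [e] is controlled by the conditional
   concentration inequality. *)
Let conditional_osc (z e : R) (F : {set T}) (p : {perm T}) :
  (#|F| <= 4)%N -> 0 <= e ->
  pavg (~: F) (fun s =>
    (W (s * p)%g + e) * stein_sol z (W (s * p)%g + e) -
    (W (s * p)%g - e) * stein_sol z (W (s * p)%g - e)
    + (`|W (s * p)%g - z| <= e)%R%:R) <=
  2 * Num.min 1 (5 / 2 * e) + 20 * d.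
Proof.
move=> F4 e0; set G := ~: F.
pose B i k := a i (p k); pose Y := permstat G B.
pose c := \sum_(x in F) a x (p x).
have WE s : perm_on G s -> W (s * p)%g = Y s + c.
  move=> Gs; rewrite /permstat sum_setT (bigID (fun x => x \in G)) /=.
  congr (_ + _); first by apply: eq_bigr => x _; rewrite /B permM.
  apply: eq_big => [x|x xG]; first by rewrite !inE negbK.
  by rewrite permM (out_perm Gs).
pose g u := (u + c) * stein_sol z (u + c).
have conc x : pavg G (fun s => (x <= Y s <= x + 2 * e)%R%:R) <= 5 / 2 * (e + 4 * d).
  have := conditional_concentration a T_gt1 var1 beta_le F p x (x + 2 * e) F4.
  have -> : (x + 2 * e - x) / 2 = e by field.
  apply; lra.
have gmono : {homo g : x y / x <= y}.
  by move=> x y xy; apply: (mul_stein_sol_homo z); rewrite lerD2r.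
have gb u : Phi z - 1 <= g u <= Phi z - 1 + 1.
  by rewrite subrK; exact: mul_stein_sol_bounds.
rewrite (eq_pavg _ _ (fun s => (g (Y s + e) - g (Y s - e)) +
  (z - c - e <= Y s <= z - c - e + 2 * e)%R%:R)); last first.
  move=> s Gs; rewrite WE// /g !(addrAC _ c); congr (_ + _).
  rewrite ler_norml; congr (_ %:R); congr nat_of_bool; apply/idP/idP; lra.
rewrite pavgD.
have h1 := pavg_homo_osc G Y g (Phi z - 1) e _ gmono gb conc.
have h2 := conc (z - c - e).
have h3 : pavg G (fun s => g (Y s + e) - g (Y s - e)) <= 1.
  rewrite -[X in _ <= X](pavg_cst G); apply: ler_pavg => s _.
  have := gb (Y s + e); have := gb (Y s - e); lra.
have h4 : pavg G (fun s => (z - c - e <= Y s <= z - c - e + 2 * e)%R%:R) <= (1 : R).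
  rewrite -[X in _ <= X](pavg_cst G); apply: ler_pavg => s _.
  by case: (_ <= _ <= _).
have d0 : 0 < d by have := beta_gt0 a T_gt1 var1; lra.
(* Each of the two parts is at most 1 and at most [5 / 2 * (e + 4 * d)]. *)
by case: (leP 1 (5 / 2 * e)) => ?; lra.
Qed.

(** The radius [eta] covers both arguments of the Stein solution. Given the images of [i], [j], [k]
    and [l], the increments and [eta] are constants, so that [conditional_osc] applies. *)
Let osc_le (z : R) i j k l : j != i -> l != i ->
  pavg [set: T] (fun p => `|D i j k l p * (stein_sol z (W (p2 i j k l p)) -
      stein_sol z (W (tperm i j * p2 i j k l p)%g)) -
    D i j k l p ^+ 2 * (W p * stein_sol z (W p) + (W p <= z)%R%:R - Phi z)|) <=
  pavg [set: T] (fun p => 20 * d * D i j k l p ^+ 2 +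
    100 / 13 * (3 * trunc3 (D i j k l p) + trunc3 (U1 i k p) +
       trunc3 (U2 i j k l p))).
Proof.
move=> ji li.
pose eta p := `|U1 i k p| + `|U2 i j k l p| + `|D i j k l p|.
have eta0 p : 0 <= eta p by rewrite !addr_ge0.
pose osc p e := (W p + e) * stein_sol z (W p + e) -
  (W p - e) * stein_sol z (W p - e) + (`|W p - z| <= e)%R%:R.
apply: (@le_trans _ _ (pavg [set: T] (fun p => D i j k l p ^+ 2 * osc p (eta p)))).
  apply: ler_pavg => p _; rewrite /osc; apply: stein_sol_osc.
    have -> : W (p2 i j k l p) - W p = - (U1 i k p + U2 i j k l p).
      by rewrite /U1 /U2; ring.
    rewrite normrN; apply: (le_trans (ler_normD _ _)).
    by rewrite /eta lerDl.
  have -> : W (tperm i j * p2 i j k l p)%g - W p =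
      - (U1 i k p + U2 i j k l p + D i j k l p) by rewrite /U1 /U2 /D; ring.
  rewrite normrN; apply: (le_trans (ler_normD _ _)); rewrite lerD2r.
  exact: ler_normD.
pose F := [set i; j; k; l].
have F4 : (#|F| <= 4)%N.
  by rewrite /F !cardsU !cards1; lia.
rewrite (pavg_cond (~: F)); apply: ler_pavg => p _.
have fix_ s x : perm_on (~: F) s -> x \in F -> (s * p)%g x = p x.
  by move=> Fs xF; rewrite permM (out_perm Fs)// inE negbK.
have iF : i \in F by rewrite !inE eqxx.
have jF : j \in F by rewrite !inE eqxx !orbT.
have kF : k \in F by rewrite !inE eqxx !orbT.
have lF : l \in F by rewrite !inE eqxx !orbT.
have tF x y z' : x \in F -> y \in F -> z' \in F -> tperm x y z' \in F.
  by move=> xF yF zF; case: tpermP.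
have p1s s x : perm_on (~: F) s -> x \in F -> p1 i k (s * p)%g x = p1 i k p x.
  by move=> Fs xF; rewrite /p1 !permM -(permM s p) fix_ ?tF.
have Ds s : perm_on (~: F) s -> D i j k l (s * p)%g = D i j k l p.
  by move=> Fs; rewrite !D_E// fix_// p1s.
have U1s s : perm_on (~: F) s -> U1 i k (s * p)%g = U1 i k p.
  by move=> Fs; rewrite /U1 /p1 !W_swap !fix_.
have U2s s : perm_on (~: F) s -> U2 i j k l (s * p)%g = U2 i j k l p.
  by move=> Fs; rewrite /U2 /p2 !W_swap !p1s.
rewrite (eq_pavg _ _ (fun s => D i j k l p ^+ 2 * osc (s * p)%g (eta p))); last first.
  by move=> s Fs; rewrite /eta Ds// U1s// U2s.
rewrite pavgZ.
have := conditional_osc z (eta p) F p F4 (eta0 p); rewrite -/(osc _ _) => h.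
apply: (le_trans (ler_wpM2l (sqr_ge0 _) h)).
rewrite mulrDr [X in _ + X]mulrC addrC lerD2l.
pose m u : R := Num.min 1 `|65 / 100 * u|.
(* [50 / 13] is the quotient of [5 / 2] by [65 / 100]. *)
have mE u : Num.min 1 (5 / 2 * `|u|) <= 50 / 13 * m u.
  rewrite /m normrM (ger0_norm (_ : 0 <= 65 / 100)); last lra.
  have := normr_ge0 u => u0.
  by case: (leP 1 (5 / 2 * `|u|)) => ?; case: (leP 1 (65 / 100 * `|u|)) => ?; lra.
have min_eta : Num.min 1 (5 / 2 * eta p) <=
    50 / 13 * (m (U1 i k p) + m (U2 i j k l p) + m (D i j k l p)).
  have := mE (U1 i k p); have := mE (U2 i j k l p); have := mE (D i j k l p).
  have : Num.min 1 (5 / 2 * eta p) <= Num.min 1 (5 / 2 * `|U1 i k p|) +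
     Num.min 1 (5 / 2 * `|U2 i j k l p|) + Num.min 1 (5 / 2 * `|D i j k l p|).
    rewrite /eta !mulrDr; apply: (le_trans (min1D _ _ _ _ _)).
    - by rewrite addr_ge0// mulr_ge0.
    - by rewrite mulr_ge0.
    by rewrite lerD2r; apply: min1D; rewrite mulr_ge0.
  lra.
(* Both factors grow with the absolute value, so the product is at most [trunc3] of the larger
   argument. *)
have cheb u v : u ^+ 2 * m v <= trunc3 u + trunc3 v.
  have mono x y : `|x| <= `|y| -> m x <= m y.
    move=> xy; rewrite /m !normrM le_min ge_min lexx /= ge_min.
    by rewrite ler_wpM2l ?orbT.
  rewrite /trunc3 -/(m u) -/(m v).
  have [uv|/ltW vu] := leP `|u| `|v|.
    have : u ^+ 2 * m v <= v ^+ 2 * m v.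
      rewrite ler_wpM2r ?le_min ?ler01 ?normr_ge0//.
      rewrite -(real_normK (num_real u)) -(real_normK (num_real v)).
      by apply: lerXn2r; rewrite ?nnegrE.
    have := trunc3_ge0 u; rewrite /trunc3 -/(m u); lra.
  have := ler_wpM2l (sqr_ge0 u) (mono _ _ vu).
  have := trunc3_ge0 v; rewrite /trunc3 -/(m v); lra.
have := ler_wpM2l (sqr_ge0 (D i j k l p)) min_eta.
have := cheb (D i j k l p) (U1 i k p); have := cheb (D i j k l p) (U2 i j k l p).
have : D i j k l p ^+ 2 * m (D i j k l p) = trunc3 (D i j k l p) by [].
lra.
Qed.

Lemma permstat_normal_approx_small (z : R) :
  `|pavg [set: T] (fun p => (W p <= z)%R%:R) - Phi z| <= 55 * b.
Proof.
have n2 := n_ge2; have b0 := beta_gt0 a T_gt1 var1.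
have n100 := card_ge100 a T_gt1 var1 beta_le.
set c0 := (4 * n ^+ 2 * (n - 1))^-1.
have c0p : 0 <= c0 by rewrite invr_ge0 ltW.
have S3 : sum4 [set: T] (fun i j k l => trunc3 (cd i j k l)) =
   4 * n ^+ 2 * (n - 1) * b by rewrite /beta mulVKf// gt_eqF.
pose h w := w * stein_sol z w + (w <= z)%R%:R - Phi z.
(* The average of [h (W p)] exceeds this difference by that of [W p * stein_sol z (W p)], which
   [stein_W] expands; by [sumQ_D] the weights [c0 * D ^ 2] sum to 1 for every [p]. *)
have -> : pavg [set: T] (fun p => (W p <= z)%R%:R) - Phi z =
  - (c0 * sumQ (fun i j k l => pavg [set: T] (fun p =>
     D i j k l p * (stein_sol z (W (p2 i j k l p)) -
       stein_sol z (W (tperm i j * p2 i j k l p)%g)) -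
     D i j k l p ^+ 2 * h (W p)))).
  have -> : sumQ (fun i j k l => pavg [set: T] (fun p =>
     D i j k l p * (stein_sol z (W (p2 i j k l p)) -
       stein_sol z (W (tperm i j * p2 i j k l p)%g)) -
     D i j k l p ^+ 2 * h (W p))) =
     sumQ (fun i j k l => pavg [set: T] (fun p =>
     D i j k l p * (stein_sol z (W (p2 i j k l p)) -
       stein_sol z (W (tperm i j * p2 i j k l p)%g)))) +
     (-1) * sumQ (fun i j k l => pavg [set: T] (fun p =>
         D i j k l p ^+ 2 * h (W p))).
    rewrite -sumQZ -sumQD; apply: eq_sumQ => i j k l _ _.
    by rewrite mulN1r -pavgB.
  rewrite mulrDr -stein_W sumQ_pavg.
  have -> : pavg [set: T] (fun p => sumQ (fun i j k l => D i j k l p ^+ 2 * h (W p))) =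
     (4 * n ^+ 2 * (n - 1)) * pavg [set: T] (fun p => h (W p)).
    rewrite -pavgZ; apply: eq_pavg => p _.
    rewrite -var1 -(sumQ_D (fun u => u ^+ 2) p) ?expr0n// mulrC -sumQZ.
    by apply: eq_sumQ => i j k l _ _; rewrite mulrC.
  rewrite mulN1r mulrN /c0 mulKf ?gt_eqF// opprD opprK [RHS]addrC -pavgB.
  rewrite -[X in _ - X](pavg_cst [set: T]) -pavgB.
  by apply: eq_pavg => p _; rewrite /h; ring.
rewrite normrN normrM (ger0_norm c0p).
apply: (@le_trans _ _ (c0 * sumQ (fun i j k l => pavg [set: T] (fun p =>
    20 * d * D i j k l p ^+ 2 +
    100 / 13 * (3 * trunc3 (D i j k l p) + trunc3 (U1 i k p) +
       trunc3 (U2 i j k l p)))))).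
  apply: ler_wpM2l => //; rewrite /sumQ.
  apply: (le_trans (ler_norm_sum _ _ _)); apply: ler_sum => i _.
  apply: (le_trans (ler_norm_sum _ _ _)); apply: ler_sum => j ji.
  apply: (le_trans (ler_norm_sum _ _ _)); apply: ler_sum => k _.
  apply: (le_trans (ler_norm_sum _ _ _)); apply: ler_sum => l li.
  apply: (le_trans (pavg_norm _ _)); exact: osc_le.
have -> : sumQ (fun i j k l => pavg [set: T] (fun p =>
    20 * d * D i j k l p ^+ 2 +
    100 / 13 * (3 * trunc3 (D i j k l p) + trunc3 (U1 i k p) +
       trunc3 (U2 i j k l p)))) =
  20 * d * (4 * n ^+ 2 * (n - 1)) +
  100 / 13 * (3 * (4 * n ^+ 2 * (n - 1) * b) +
    sumQ (fun i j k l => pavg [set: T] (fun p => trunc3 (U1 i k p))) +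
    sumQ (fun i j k l => pavg [set: T] (fun p => trunc3 (U2 i j k l p)))).
  have -> : 4 * n ^+ 2 * (n - 1) =
      sumQ (fun i j k l => pavg [set: T] (fun p => D i j k l p ^+ 2)).
    rewrite sumQ_pavg -[LHS](pavg_cst [set: T]); apply: eq_pavg => p _.
    by rewrite (sumQ_D (fun u => u ^+ 2))// expr0n.
  have {}S3 : sumQ (fun i j k l => pavg [set: T] (fun p => D i j k l p ^+ 2)) * b =
      sumQ (fun i j k l => pavg [set: T] (fun p => trunc3 (D i j k l p))).
    rewrite [in RHS]sumQ_pavg.
    transitivity (4 * n ^+ 2 * (n - 1) * b); last first.
      rewrite -S3 -[LHS](pavg_cst [set: T]); apply: eq_pavg => p _.
      by rewrite sumQ_D// trunc3_0.
    congr (_ * _); rewrite sumQ_pavg -[RHS](pavg_cst [set: T]).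
    by apply: eq_pavg => p _; rewrite (sumQ_D (fun u => u ^+ 2))// expr0n.
  rewrite S3 -!(sumQZ, sumQD); apply: eq_sumQ => i j k l _ _.
  by rewrite !(pavgD, pavgZ).
have u1 := sumQ_U1 trunc3 trunc3_0 trunc3_ge0.
have u2 := sumQ_U2 trunc3 trunc3_0 trunc3_ge0.
rewrite S3 in u1 u2.
rewrite /c0 mulrC ler_pdivrMr//.
set N := 4 * n ^+ 2 * (n - 1) in u1 u2 *.
have Nb : 0 <= N * b by rewrite mulr_ge0 ?ltW.
(* The total [200 / 13 + 100 / 13 * (3 + 1 + 102 / 100)] is below 55. *)
have nn : n / (n - 1) * (N * b) <= 102 / 100 * (N * b).
  rewrite ler_wpM2r// ler_pdivrMr; lra.
lra.
Qed.

End combinatorial_clt.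

(** * Transfer from a random permutation to averages *)

Section uniform_permutation.
Context d (T : measurableType d) (R : realType) (P : probability T R) (n : nat).
Variable p : T -> 'S_n.
Hypothesis hp : uniform_random_perm P p.

(** The integrand is a finite combination of indicators of the fibres of [p], whose measurability
    and probabilities are given. *)
Lemma expectation_uniform_perm (h : 'S_n -> R) :
  ('E_P[fun w => h (p w)] = (pavg [set: 'I_n] h)%:E)%E.
Proof.
pose A s := (p @^-1` [set s])%classic.
have mA s : measurable (A s) by have [] := hp s.
have hE w : (h (p w))%:E = (\sum_(s : 'S_n) (h s)%:E * (\1_(A s) w)%:E)%E.
  rewrite (bigD1 (p w))//= big1 ?adde0; last first.
    move=> s sp; rewrite indicE memNset ?mule0// /A /= => /esym/eqP.
    by rewrite (negbTE sp).
  by rewrite indicE mem_set ?mule1.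
rewrite unlock (eq_integral (fun w => \sum_(s : 'S_n) (h s)%:E * (\1_(A s) w)%:E)%E); last first.
  by move=> w _; exact: hE.
rewrite integral_sum//; last first.
  by move=> s; apply: integrableZl => //; exact: integrable_indic.
rewrite (eq_bigr (fun s => (n`!%:R^-1 * h s)%:E)); last first.
  move=> s _; rewrite integralZl//; last exact: integrable_indic.
  rewrite integral_indic// classical_sets.setIT.
  have PA : P (A s) = (n`!%:R^-1)%:E by have [] := hp s.
  by rewrite mulrC EFinM; congr (_ * _)%E.
rewrite sumEFin -mulr_sumr /pavg cardsT card_ord; congr ((_ * _)%:E).
by apply: eq_bigl => s; rewrite perm_onT.
Qed.

Lemma probability_uniform_perm (Q : pred 'S_n) :
  (P [set w | Q (p w)]%classic = (pavg [set: 'I_n] (fun s => (Q s)%:R))%:E)%E.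
Proof.
have mQ : measurable [set w | Q (p w)]%classic.
  have -> : [set w | Q (p w)]%classic =
      (\bigcup_(s in [set s | Q s]) (p @^-1` [set s]))%classic.
    apply/seteqP; split => w /=; first by move=> Qw; exists (p w).
    by move=> [s Qs /= ->].
  apply: fin_bigcup_measurable => [|s _]; first exact: finite_finset.
  by have [] := hp s.
rewrite -expectation_indic// -expectation_uniform_perm; congr expectation.
apply/funext => w; rewrite indicE; congr (_%:R); congr nat_of_bool.
by apply/idP/idP => [/set_mem //|Qw]; exact/mem_set.
Qed.

Variable A : 'M[R]_n.
Local Notation S := (fun s : 'S_n => \sum_(j < n) A j (s j)).

Lemma perm_sum_meanE : perm_sum_mean P A p = pavg [set: 'I_n] S.
Proof.
by rewrite /perm_sum_mean -[perm_sum A p]/(fun w => S (p w))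
  (expectation_uniform_perm S).
Qed.

Lemma perm_sum_sd_sqr : perm_sum_sd P A p ^+ 2 =
  pavg [set: 'I_n] (fun s => (S s - perm_sum_mean P A p) ^+ 2).
Proof.
rewrite /perm_sum_sd /variance unlock.
rewrite (_ : ((_ \- _) * (_ \- _))%R =
  fun w => (S (p w) - perm_sum_mean P A p) ^+ 2); last first.
  by apply/funext => w; rewrite expr2.
rewrite (expectation_uniform_perm (fun s => (S s - perm_sum_mean P A p) ^+ 2)) /=.
by rewrite sqr_sqrtr// pavg_ge0// => s _; exact: sqr_ge0.
Qed.

End uniform_permutation.

(** The constant is [4 * C1], [beta] being a quarter of the normalised [gamma]. It exceeds 63, so
    the bound is trivial once [beta a > 1 / 63]; otherwise the constant 55 applies. *)
Lemma permstat_normal_approx (R : realType) (T : finType) (a : T -> T -> R) :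
  (1 < #|T|)%N -> permstat_mean [set: T] a = 0 ->
  pavg [set: T] (fun s => permstat [set: T] a s ^+ 2) = 1 ->
  forall z, `|pavg [set: T] (fun s => (permstat [set: T] a s <= z)%R%:R) - Phi z|
    <= 1584 / 25 * beta a.
Proof.
move=> T1 mean0 var z.
have n2 : 2 <= #|T|%:R :> R by rewrite ler_nat.
have T1' : (1 < #|[set: T]|)%N by rewrite cardsT.
have var1 : sum4 [set: T] (fun i j k l => crossdiff a i j k l ^+ 2) =
    4 * #|T|%:R ^+ 2 * (#|T|%:R - 1).
  have := permstat_var [set: T] a (ltnW T1').
  have z0 : (0 : R) ^+ 2 = 0 by rewrite expr0n.
  rewrite (sum_pavg_crossdiff [set: T] a (fun u => u ^+ 2) z0 T1').
  rewrite mean0 cardsT (eq_pavg _ _ (fun s => permstat [set: T] a s ^+ 2)); last first.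
    by move=> s _; rewrite subr0.
  rewrite var -/(sum4 _ (fun i j k l => crossdiff a i j k l ^+ 2)) => h.
  have N0 : 4 * #|T|%:R * (#|T|%:R * (#|T|%:R - 1)) != 0 :> R.
    by rewrite !mulf_neq0//; apply: lt0r_neq0; lra.
  have := congr1 ( *%R (4 * #|T|%:R * (#|T|%:R * (#|T|%:R - 1)))) h.
  by rewrite [X in _ = _ * X]mulrA -invfM mulVKf// => <-; ring.
have b0 := beta_gt0 a T1 var1.
have [b63|b63] := leP (beta a) (1 / 63).
  have := permstat_normal_approx_small a T1 mean0 var1 b63 z; lra.
have p0 : 0 <= pavg [set: T] (fun s => (permstat [set: T] a s <= z)%R%:R) :> R.
  by apply: pavg_ge0.
have p1 : pavg [set: T] (fun s => (permstat [set: T] a s <= z)%R%:R) <= 1 :> R.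
  rewrite -[X in _ <= X](pavg_cst [set: T]); apply: ler_pavg => s _.
  by case: (permstat _ _ _ <= z).
have := Phi_ge0 z; have := Phi_le1 z; rewrite ler_norml; lra.
Qed.

Theorem theorem1p1 (R : realType) (n : nat) (hn : (2 <= n)%N) (A : 'M[R]_n)
    (d : measure_display) (T : measurableType d) (P : probability T R)
    (p : T -> 'S_n) (hp : uniform_random_perm P p)
    (hsd : 0 < perm_sum_sd P A p ^+ 2) :
  C1 * C2 <= 103 / 10 :> R /\
  dist_to_normal P (perm_sum_std P A p) <=
    C1 / perm_sum_sd P A p ^+ 2 * gamma A (C2 / perm_sum_sd P A p).
Proof.
split; first by rewrite /C1 /C2; lra.
set sd := perm_sum_sd P A p in hsd *; set mu := perm_sum_mean P A p.
have sd0 : 0 < sd by rewrite lt0r -sqrf_eq0 gt_eqF//= sqrtr_ge0.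
have n2 : 2 <= n%:R :> R by rewrite ler_nat.
(* Spreading the mean evenly over the entries standardises the sum and only divides the second
   differences by [sd]. *)
pose a (i k : 'I_n) : R := (A i k - mu / n%:R) / sd.
pose W := permstat [set: 'I_n] a.
have WE s : W s = (\sum_(j < n) A j (s j) - mu) / sd.
  rewrite /W /permstat sum_setT -mulr_suml sumrB sumr_const card_ord -[_ *+ n]mulr_natl.
  by congr (_ * _); congr (_ - _); field; lra.
have T1 : (1 < #|'I_n|)%N by rewrite card_ord.
have T0 : (0 < #|[set: 'I_n]|)%N by rewrite cardsT ltnW.
have avgW : pavg [set: 'I_n] W = 0.
  rewrite (eq_pavg _ _ (fun s => sd^-1 * (\sum_(j < n) A j (s j) - mu))); last first.
    by move=> s _; rewrite WE mulrC.
  by rewrite pavgZ pavgB pavg_cst -(perm_sum_meanE _ _ _ _ _ _ hp) subrr mulr0.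
have mean0 : permstat_mean [set: 'I_n] a = 0 by rewrite -pavg_permstat.
have var1 : pavg [set: 'I_n] (fun s => W s ^+ 2) = 1.
  rewrite (eq_pavg _ _ (fun s => (sd ^+ 2)^-1 * (\sum_(j < n) A j (s j) - mu) ^+ 2)).
    by rewrite pavgZ -(perm_sum_sd_sqr _ _ _ _ _ _ hp) mulVf// gt_eqF.
  by move=> s _; rewrite WE exprMn exprVn mulrC.
have -> : C1 / sd ^+ 2 * gamma A (C2 / sd) = 1584 / 25 * beta a.
  have cdE i j k l : trunc3 (crossdiff a i j k l) = (sd ^+ 2)^-1 *
      (bdiff A i j k l ^+ 2 * Num.min 1 `|C2 / sd * bdiff A i j k l|).
    have -> : crossdiff a i j k l = bdiff A i j k l / sd.
      by rewrite /crossdiff /a /bdiff; ring.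
    rewrite /trunc3 exprMn exprVn /C2 -!mulrA [sd^-1 * _]mulrC; ring.
  rewrite /beta card_ord sum4_setT /gamma /C1.
  set g := \sum_(j < n) _; set S := \sum_(i < n) _.
  (* The quadruples with [i = j] or [k = l], absent from [gamma], contribute 0 to [beta]. *)
  have -> : S = (sd ^+ 2)^-1 * g.
    rewrite /S /g mulr_sumr; apply: eq_bigr => i _.
    rewrite mulr_sumr [in RHS]big_mkcond; apply: eq_bigr => j _.
    have [<-|ij] := eqVneq i j.
      rewrite big1// => k _; rewrite big1// => l _.
      rewrite -[RHS]trunc3_0; congr trunc3; rewrite /crossdiff; ring.
    rewrite mulr_sumr; apply: eq_bigr => k _.
    rewrite mulr_sumr [in RHS]big_mkcond; apply: eq_bigr => l _.
    have [<-|kl] := eqVneq k l; last exact: cdE.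
    rewrite -[RHS]trunc3_0; congr trunc3; rewrite /crossdiff; ring.
  by field; apply/and3P; split; apply: lt0r_neq0; lra.
apply: ge_sup.
  by exists (`|fine (P [set w | perm_sum_std P A p w <= 0]%classic) - Phi 0|); exists 0.
move=> _ [x _ <-].
have := permstat_normal_approx R 'I_n a T1 mean0 var1 x.
suff -> : fine (P [set w | perm_sum_std P A p w <= x]%classic) =
    pavg [set: 'I_n] (fun s => (W s <= x)%R%:R) by [].
rewrite -[RHS]/(fine (_%:E)%E) -(probability_uniform_perm _ _ _ _ _ _ hp (fun s => W s <= x)).
by congr (fine (P _)); apply/funext => w /=; rewrite WE.
Qed.
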